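(* Let $R$ be a commutative Noetherian semiperfect ring, let $C$ be a semidualizing $R$-module, let $M$ be a finite $R$-module, and let $n$ and $t$ be two integers. Then the following statements are equivalent: (i) $M$ is reduced $\mathrm{G}_C$-perfect of $\mathrm{G}_C$-dimension $n$ and $\mathrm{Ext}_R^n(M,C)$ is $\mathrm{G}_C$-perfect of $\mathrm{G}_C$-dimension $n+t-1$; (ii) $\mathrm{Tr}_C(M)$ is reduced $\mathrm{G}_C$-perfect of $\mathrm{G}_C$-dimension $t$ and $\mathrm{Ext}_R^t(\mathrm{Tr}_C(M),C)$ is $\mathrm{G}_C$-perfect of $\mathrm{G}_C$-dimension $n+t-1$.
   Context: A commutative Noetherian ring is semiperfect iff it is a finite direct product of local rings. ''Finite'' module means finitely generated. A finite $R$-module $C$ is semidualizing if the homothety map $R\to\mathrm{Hom}_R(C,C)$ is an isomorphism and $\mathrm{Ext}^i_R(C,C)=0$ for all $i>0$. Write $(-)^C=\mathrm{Hom}_R(-,C)$. A finite module $X$ is totally $C$-reflexive if the biduality map $X\to X^{CC}$ is an isomorphism and $\mathrm{Ext}^i_R(X,C)=\mathrm{Ext}^i_R(X^C,C)=0$ for all $i>0$. For a finite module $M$, $\mathrm{G}_C\text{-}\dim_R(M)$ is the smallest $n\ge 0$ such that there is an exact sequence $0\to X_n\to\cdots\to X_0\to M\to 0$ with all $X_i$ totally $C$-reflexive, and $\infty$ if no such $n$ exists. $\mathrm{grade}_R(M)=\inf\{i\ge 0\mid \mathrm{Ext}^i_R(M,R)\ne 0\}$ and $\mathrm{r.grade}_R(M,C)=\inf\{i>0\mid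 \mathrm{Ext}^i_R(M,C)\ne 0\}$ (with $\inf\emptyset=\infty$). A finite module $M$ with finite $\mathrm{G}_C$-dimension is $\mathrm{G}_C$-perfect if $\mathrm{grade}_R(M)=\mathrm{G}_C\text{-}\dim_R(M)$, and reduced $\mathrm{G}_C$-perfect if $\mathrm{r.grade}_R(M,C)=\mathrm{G}_C\text{-}\dim_R(M)$ (so in the latter case its $\mathrm{G}_C$-dimension is automatically positive). If $P_1\xrightarrow{f}P_0\to M\to 0$ is a presentation by finite projective modules, $\mathrm{Tr}_C(M)=\mathrm{Coker}(f^C\colon P_0^C\to P_1^C)$; it is unique up to adding direct summands of finite direct sums of copies of $C$, and the properties above do not depend on the choice. *)

(* Defs.v *)
From HB Require Import structures.
From mathcomp Require Import all_boot all_order all_algebra all_classical constructive_ereal.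
Set Implicit Arguments.
Unset Strict Implicit.
Unset Printing Implicit Defensive.
Import Order.TTheory GRing.Theory Num.Theory.
Local Open Scope classical_set_scope.
Local Open Scope ring_scope.

Definition submodule (R : pzRingType) (V : lmodType R) (S : submodClosed V) :=
  {x : V | x \in S}.

Section Submodule.
Variables (R : pzRingType) (V : lmodType R) (S : submodClosed V).
HB.instance Definition _ := SubChoice.on (submodule S).
Fact submodule_closed : subsemimod_closed (fun x : V => x \in S).
Proof.
split; first by split=> [|x y]; [exact: (rpred0 S) | exact: (@rpredD _ S)].
by move=> a x; exact: (@rpredZ _ _ S).
Qed.
HB.instance Definition _ :=
  GRing.SubChoice_isSubLmodule.Build R V _ (submodule S) submodule_closed.
End Submodule.

Section QuotientModule.
Variables (R : pzRingType) (V : lmodType R) (S : submodClosed V).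

(* Copy of S, registered as a subgroup for ring_quotient. *)
Definition sub_zmod : {pred V} := fun x => x \in S.
Fact sub_zmod_closed : zmod_closed sub_zmod.
Proof.
split=> [|x y]; first exact: (rpred0 S).
move=> Sx Sy; rewrite -scaleN1r; apply: (@rpredD _ S) => //.
exact: (@rpredZ _ _ S).
Qed.
HB.instance Definition _ := GRing.isZmodClosed.Build V sub_zmod sub_zmod_closed.

Definition quotmod := @Quotient.quot V sub_zmod.
HB.instance Definition _ := GRing.Zmodule.on quotmod.

Definition quotmod_pi (x : V) : quotmod := (\pi_(quotmod) x)%qT.

Lemma quotmod_eq x y : quotmod_pi x = quotmod_pi y <-> x - y \in S.
Proof.
by rewrite (Quotient.idealrBE sub_zmod x y); split=> [e|/eqP //]; apply/eqP.
Qed.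

Lemma quotmod_piK (q : quotmod) : quotmod_pi (repr q) = q.
Proof. exact: reprK. Qed.

Lemma quotmod_pi_zmod : zmod_morphism quotmod_pi.
Proof. exact: pi_is_zmod_morphism. Qed.

Lemma quotmod_piD x y : quotmod_pi (x + y) = quotmod_pi x + quotmod_pi y.
Proof. exact: (Quotient.pi_add sub_zmod x y). Qed.

Definition quotmod_scale (a : R) (q : quotmod) := quotmod_pi (a *: repr q).

Lemma quotmod_scaleE a x : quotmod_scale a (quotmod_pi x) = quotmod_pi (a *: x).
Proof.
apply/quotmod_eq; rewrite -scalerBr rpredZ //.
by apply/quotmod_eq; rewrite quotmod_piK.
Qed.

Fact quotmod_scaleA a b q :
  quotmod_scale a (quotmod_scale b q) = quotmod_scale (a * b) q.
Proof. by rewrite -[q]quotmod_piK !quotmod_scaleE scalerA. Qed.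
Fact quotmod_scale1 : left_id 1 quotmod_scale.
Proof. by move=> q; rewrite -[q]quotmod_piK quotmod_scaleE scale1r. Qed.
Fact quotmod_scaleDr : right_distributive quotmod_scale +%R.
Proof.
move=> a p q; rewrite -[p]quotmod_piK -[q]quotmod_piK -quotmod_piD.
by rewrite !quotmod_scaleE scalerDr quotmod_piD.
Qed.
Fact quotmod_scaleDl q : {morph quotmod_scale^~ q : a b / a + b}.
Proof.
move=> a b; rewrite -[q]quotmod_piK !quotmod_scaleE scalerDl.
exact: quotmod_piD.
Qed.
HB.instance Definition _ := GRing.Zmodule_isLmodule.Build R quotmod
  quotmod_scaleA quotmod_scale1 quotmod_scaleDr quotmod_scaleDl.

Fact quotmod_pi_linear : linear quotmod_pi.
Proof.
by move=> a x y; rewrite quotmod_piD -quotmod_scaleE.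
Qed.
HB.instance Definition _ :=
  GRing.isLinear.Build R V quotmod *:%R quotmod_pi quotmod_pi_linear.

End QuotientModule.

Section KernelImage.
Variables (R : pzRingType) (U V : lmodType R).

Definition ker (f : {linear U -> V}) : {pred U} := fun x => f x == 0.
Fact ker_submod_closed f : submod_closed (ker f).
Proof.
split=> [|a x y]; rewrite !unfold_in /ker ?linear0 // => /eqP fx /eqP fy.
by rewrite linearP fx fy scaler0 addr0.
Qed.
HB.instance Definition _ f := GRing.isSubmodClosed.Build R U (ker f)
  (ker_submod_closed f).

Definition im (f : {linear U -> V}) : {pred V} := fun y => `[< exists x, f x = y >].
Fact im_submod_closed f : submod_closed (im f).
Proof.
split=> [|a x y]; rewrite !unfold_in /im.
  by apply/asboolP; exists 0; rewrite linear0.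
move=> /asboolP[x' <-] /asboolP[y' <-]; apply/asboolP.
by exists (a *: x' + y'); rewrite linearP.
Qed.
HB.instance Definition _ f := GRing.isSubmodClosed.Build R V (im f)
  (im_submod_closed f).

Definition coker (f : {linear U -> V}) : lmodType R := quotmod (im f).

Definition preim_of (f : {linear U -> V}) (S : submodClosed V) : {pred U} :=
  fun x => f x \in S.
Fact preim_of_submod_closed f S : submod_closed (preim_of f S).
Proof.
split=> [|a x y fx fy]; rewrite unfold_in /preim_of.
  by rewrite linear0 (rpred0 S).
by rewrite linearP; apply: (@rpredD _ S) => //; exact: (@rpredZ _ _ S).
Qed.
HB.instance Definition _ f S := GRing.isSubmodClosed.Build R U (preim_of f S)
  (preim_of_submod_closed f S).

End KernelImage.

Definition zero_sub (R : pzRingType) (V : lmodType R) : {pred V} := fun x => x == 0.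
Fact zero_sub_submod_closed (R : pzRingType) (V : lmodType R) :
  submod_closed (@zero_sub R V).
Proof.
split=> [|a x y]; rewrite !unfold_in /zero_sub // => /eqP-> /eqP->.
by rewrite scaler0 addr0.
Qed.
HB.instance Definition _ (R : pzRingType) (V : lmodType R) :=
  GRing.isSubmodClosed.Build R V (@zero_sub R V) (@zero_sub_submod_closed R V).

(* Z / (Z :&: B); it is only used for B contained in Z. *)
Definition subquot (R : pzRingType) (V : lmodType R) (Z B : submodClosed V) :
  lmodType R :=
  quotmod (preim_of (\val : submodule Z -> V) B).

Definition trivial_mod (R : pzRingType) (V : lmodType R) := forall x : V, x = 0.

Section Hom.
Variable R : comPzRingType.

Definition is_lin (M N : lmodType R) : {pred M -> N} := fun f => `[< linear f >].
Fact is_lin_submod_closed M N : submod_closed (@is_lin M N).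
Proof.
split=> [|a f g]; rewrite !unfold_in /is_lin.
  by apply/asboolP => k x y /=; rewrite scaler0 addr0.
move=> /asboolP lf /asboolP lg; apply/asboolP => k x y.
rewrite -[LHS]/(a *: f _ + g _) -[in RHS]/(k *: (a *: f x + g x) + (a *: f y + g y)).
by rewrite lf lg !scalerDr !scalerA [a * k]mulrC addrACA.
Qed.
HB.instance Definition _ (M N : lmodType R) :=
  GRing.isSubmodClosed.Build R (M -> N) (@is_lin M N) (@is_lin_submod_closed M N).

Definition Hom (M N : lmodType R) : lmodType R := submodule (@is_lin M N).

Definition hom_fun (M N : lmodType R) (h : Hom M N) : M -> N := \val h.
Fact hom_fun_linear M N (h : Hom M N) : linear (hom_fun h).
Proof. by apply/asboolP; exact: (valP h). Qed.
HB.instance Definition _ (M N : lmodType R) (h : Hom M N) :=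
  GRing.isLinear.Build R M N *:%R (hom_fun h) (hom_fun_linear h).

Fact hom_of_subproof (M N : lmodType R) (f : {linear M -> N}) :
  (f : M -> N) \in @is_lin M N.
Proof. by apply/asboolP; exact: linearP. Qed.
Definition hom_of (M N : lmodType R) (f : {linear M -> N}) : Hom M N :=
  Sub (f : M -> N) (hom_of_subproof f).

Lemma hom_ext M N (g h : Hom M N) : hom_fun g =1 hom_fun h -> g = h.
Proof. by move=> e; apply/val_inj/funext. Qed.

(* f^N : Hom(B, N) -> Hom(A, N), precomposition with f : A -> B *)
Definition hom_pre (A B : lmodType R) (f : {linear A -> B}) (N : lmodType R)
  (h : Hom B N) : Hom A N := hom_of (hom_fun h \o f).
Fact hom_pre_linear (A B : lmodType R) (f : {linear A -> B}) (N : lmodType R) :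
  linear (@hom_pre A B f N).
Proof. by move=> a g h; apply: hom_ext. Qed.
HB.instance Definition _ (A B : lmodType R) (f : {linear A -> B}) (N : lmodType R) :=
  GRing.isLinear.Build R (Hom B N) (Hom A N) *:%R (@hom_pre A B f N)
    (@hom_pre_linear A B f N).

Definition homothety (C : lmodType R) (r : R) : Hom C C := hom_of ( *:%R r).

Section Biduality.
Variables X C : lmodType R.
Definition eval_at (x : X) (h : Hom X C) : C := hom_fun h x.
Fact eval_at_linear x : linear (eval_at x).
Proof. by []. Qed.
HB.instance Definition _ x :=
  GRing.isLinear.Build R (Hom X C) C *:%R (eval_at x) (eval_at_linear x).
Definition biduality (x : X) : Hom (Hom X C) C := hom_of (eval_at x).
End Biduality.

End Hom.

Section Free.
Variable R : pzRingType.

(* R^(T), as the functions T -> R of finite support *)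
Definition fin_supp (T : choiceType) : {pred T -> R^o} :=
  fun f => `[< finite_set [set x | f x != 0] >].
Fact fin_supp_submod_closed T : submod_closed (@fin_supp T).
Proof.
split=> [|a f g]; rewrite !unfold_in /fin_supp.
  apply/asboolP; rewrite (_ : [set _ | _] = set0) ?finite_set0 //.
  by apply/seteqP; split=> // x /=; rewrite eqxx.
move=> /asboolP ff /asboolP fg; apply/asboolP.
apply: (@sub_finite_set _ _ ([set x | f x != 0] `|` [set x | g x != 0])).
  move=> x /= fgx; have [fx|] := eqVneq (f x) 0; last by left.
  right; apply: contra fgx => /eqP gx.
  by rewrite -[X in X == 0]/(a *: f x + g x) fx gx scaler0 addr0.
by rewrite finite_setU.
Qed.
HB.instance Definition _ (T : choiceType) :=
  GRing.isSubmodClosed.Build R (T -> R^o) (@fin_supp T)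
    (@fin_supp_submod_closed T).

Definition free (T : choiceType) : lmodType R := submodule (@fin_supp T).

Definition free_coef (T : choiceType) (f : free T) (x : T) : R := \val f x.

(* The linear map R^(T) -> A sending the basis element of x to phi x *)
Definition free_ext (T : choiceType) (A : lmodType R) (phi : T -> A)
    (f : free T) : A :=
  \big[+%R/0]_(x \in [set: T]) (free_coef f x *: phi x).

Lemma free_extE (T : choiceType) (A : lmodType R) (phi : T -> A) (f : free T)
    (r : seq T) :
  uniq r -> (forall x, free_coef f x != 0 -> x \in r) ->
  free_ext phi f = \sum_(x <- r) free_coef f x *: phi x.
Proof.
move=> ur fr; rewrite /free_ext (fsbigE r) //=.
  by apply: eq_bigl => x; rewrite in_setT.
move=> x _ xr; suff -> : free_coef f x = 0 by rewrite scale0r.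
by apply/eqP; apply: contraNT xr; exact: fr.
Qed.

Lemma free_supp (T : choiceType) (f : free T) :
  exists2 r : seq T, uniq r & forall x, free_coef f x != 0 -> x \in r.
Proof.
have /asboolP/finite_seqP[r fr] := valP f.
exists (undup r) => [|x fx]; rewrite ?undup_uniq // mem_undup.
by have : [set` r] x by rewrite -fr.
Qed.

Lemma free_coefP (T : choiceType) (a : R) (f g : free T) x :
  free_coef (a *: f + g) x = a * free_coef f x + free_coef g x.
Proof. by []. Qed.

Fact free_ext_linear (T : choiceType) (A : lmodType R) (phi : T -> A) :
  linear (free_ext phi).
Proof.
move=> a f g; have [r _ fr] := free_supp f; have [s _ gs] := free_supp g.
have fu x : free_coef f x != 0 -> x \in undup (r ++ s).
  by move/fr; rewrite mem_undup mem_cat => ->.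
have gu x : free_coef g x != 0 -> x \in undup (r ++ s).
  by move/gs; rewrite mem_undup mem_cat orbC => ->.
have u := undup_uniq (r ++ s).
rewrite !(@free_extE _ _ _ _ (undup (r ++ s))) //.
  rewrite scaler_sumr -big_split; apply: eq_bigr => x _ /=.
  by rewrite free_coefP scalerDl scalerA.
move=> x fgx; have [fx|/fu//] := eqVneq (free_coef f x) 0.
apply: gu; apply: contra fgx => /eqP gx.
by rewrite free_coefP fx gx mulr0 addr0.
Qed.
HB.instance Definition _ (T : choiceType) (A : lmodType R) (phi : T -> A) :=
  GRing.isLinear.Build R (free T) A *:%R (free_ext phi) (@free_ext_linear T A phi).

Fact free_basis_subproof (T : choiceType) (x : T) :
  (fun y => (y == x)%:R : R^o) \in @fin_supp T.
Proof.
apply/asboolP; apply: (sub_finite_set _ (finite_set1 x)) => y /=.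
by case: (eqVneq y x) => //=; rewrite eqxx.
Qed.
Definition free_basis (T : choiceType) (x : T) : free T :=
  Sub (fun y => (y == x)%:R : R^o) (free_basis_subproof x).

Lemma free_coef_basis (T : choiceType) (x y : T) :
  free_coef (free_basis x) y = (y == x)%:R.
Proof. by []. Qed.

Lemma free_ext_basis (T : choiceType) (A : lmodType R) (phi : T -> A) x :
  free_ext phi (free_basis x) = phi x.
Proof.
rewrite (@free_extE _ _ _ _ [:: x]) // => [|y].
  by rewrite big_seq1 free_coef_basis eqxx scale1r.
by rewrite free_coef_basis inE; case: (y == x); rewrite //= eqxx.
Qed.

Lemma free_expand (T : choiceType) (f : free T) : free_ext (@free_basis T) f = f.
Proof.
have [r ur fr] := free_supp f; rewrite (@free_extE _ _ _ _ r) //.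
apply/val_inj/funext => y; rewrite raddf_sum /= fct_sumE.
have [yr|yr] := boolP (y \in r).
  rewrite (bigD1_seq y) //=.
  rewrite -[X in X + _]/(free_coef f y * (y == y)%:R) eqxx mulr1 big1 ?addr0 // => x xy.
  by rewrite -[LHS]/(free_coef f x * (y == x)%:R) eq_sym (negPf xy) mulr0.
rewrite big1_seq => [|x /= xr].
  by apply/esym/eqP; apply: contraNT yr; exact: fr.
rewrite -[LHS]/(free_coef f x * (y == x)%:R).
by case: eqVneq xr yr => [-> ->|]; rewrite ?mulr0.
Qed.

Definition projective (P : lmodType R) := forall (A B : lmodType R)
  (g : {linear A -> B}) (h : {linear P -> B}),
  (forall b, exists a, g a = b) ->
  exists h' : {linear P -> A}, forall x, g (h' x) = h x.

Lemma free_projective (T : choiceType) : projective (free T).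
Proof.
move=> A B g h gsurj.
pose phi x := projT1 (cid (gsurj (h (free_basis x)))).
have phiE x : g (phi x) = h (free_basis x).
  by rewrite /phi; case: cid.
exists (free_ext phi) => f.
have [r ur fr] := free_supp f; rewrite -[in RHS](free_expand f).
rewrite /= (free_extE phi ur fr) (free_extE (@free_basis T) ur fr).
rewrite !linear_sum; apply: eq_bigr => x _.
by rewrite !linearZ phiE.
Qed.

(* Exactness of ... -> X 1 -> X 0 -> M -> 0 *)
Record is_resolution (M : lmodType R) (X : nat -> lmodType R)
    (d : forall i, {linear X i.+1 -> X i}) (e : {linear X 0%N -> M}) : Prop := {
  res_surj : forall m, exists x, e x = m;
  res_exact0 : forall x, e x = 0 <-> exists y, d 0%N y = x;
  res_exact : forall i x, d i x = 0 <-> exists y, d i.+1 y = x }.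

Record proj_resolution (M : lmodType R) := ProjResolution {
  pr_mod : nat -> lmodType R;
  pr_d : forall i, {linear pr_mod i.+1 -> pr_mod i};
  pr_e : {linear pr_mod 0%N -> M};
  pr_proj : forall i, projective (pr_mod i);
  pr_res : is_resolution pr_d pr_e }.

(* The resolution obtained by repeatedly covering the kernel K by R^(K) *)
Section StandardResolution.
Variable M : lmodType R.

Definition free_cover (K : lmodType R) : {linear free K -> K} := free_ext (@id K).

Fixpoint syzygy (i : nat) : lmodType R :=
  if i is j.+1 then submodule (ker (free_cover (syzygy j))) else M.

Definition std_mod i : lmodType R := free (syzygy i).
Definition std_d i : {linear std_mod i.+1 -> std_mod i} :=
  (\val : syzygy i.+1 -> std_mod i) \o free_cover (syzygy i.+1).

Lemma cover_surj (K : lmodType R) (k : K) : exists x, free_cover K x = k.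
Proof. by exists (free_basis k); exact: (free_ext_basis id k). Qed.

Lemma std_exact i x :
  free_cover (syzygy i) x = 0 <-> exists y, std_d i y = x.
Proof.
split=> [/eqP xK|[y <-]].
  have [y yE] := @cover_surj (syzygy i.+1) (Sub x xK).
  by exists y; rewrite /std_d /= yE.
exact/eqP/(valP (free_cover (syzygy i.+1) y)).
Qed.

Lemma std_is_resolution : is_resolution std_d (free_cover M).
Proof.
split=> [m|x|i x]; [exact: cover_surj|exact: (@std_exact 0%N x)|].
split=> [dx|/std_exact dx]; last exact: (congr1 \val dx).
by apply/std_exact/val_inj; exact: dx.
Qed.

Definition std_resolution : proj_resolution M :=
  ProjResolution (fun i => @free_projective (syzygy i)) std_is_resolution.
End StandardResolution.
End Free.

Section Ext.
Variable R : comPzRingType.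
Variables M N : lmodType R.

Definition cocycles (P : proj_resolution M) (i : nat) :
    submodClosed (Hom (pr_mod P i) N) :=
  ker (hom_pre (pr_d P i) (N := N)).
Definition coboundaries (P : proj_resolution M) (i : nat) :
    submodClosed (Hom (pr_mod P i) N) :=
  match i with
  | 0%N => @zero_sub R (Hom (pr_mod P 0) N)
  | j.+1 => im (hom_pre (pr_d P j) (N := N))
  end.
(* H^i of 0 -> Hom(P 0, N) -> Hom(P 1, N) -> ... *)
Definition Ext_res (P : proj_resolution M) (i : nat) : lmodType R :=
  subquot (cocycles P i) (coboundaries P i).

(* By the comparison theorem Ext_res P i does not depend on P up to isomorphism. *)
Definition Ext (i : nat) : lmodType R := Ext_res (std_resolution M) i.

(* Ext^i = 0 for i < 0 *)
Definition Extz (i : int) : lmodType R :=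
  match i with Posz k => Ext k | Negz _ => 'rV[R]_0 end.
End Ext.

Definition fin_gen (R : pzRingType) (V : lmodType R) :=
  exists (k : nat) (g : 'I_k -> V), forall x, exists c : 'I_k -> R,
    x = \sum_i c i *: g i.

(* Ideals of a commutative ring R are the submodules of R^o. *)
Definition noetherian (R : comPzRingType) :=
  forall I : submodClosed R^o, fin_gen (submodule I).

Definition maximal_ideal (R : comPzRingType) (m : submodClosed R^o) :=
  1 \notin m /\
  forall J : submodClosed R^o, {subset m <= J} -> 1 \notin J -> {subset J <= m}.

Definition local_ring (R : comPzRingType) :=
  exists m : submodClosed R^o, maximal_ideal m /\
    forall m' : submodClosed R^o, maximal_ideal m' -> m' =i m.

(* A finite direct product of local rings, through its projections p i *)
Definition semiperfect (R : comPzRingType) :=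
  exists (k : nat) (L : 'I_k -> comPzRingType) (p : forall i, {rmorphism R -> L i}),
    (forall i, local_ring (L i)) /\
    bijective (fun (r : R) (i : 'I_k) => p i r).

Section GC.
Variable R : comPzRingType.
Implicit Types C M X : lmodType R.

Definition semidualizing C :=
  [/\ fin_gen C, bijective (@homothety R C) &
      forall i, (0 < i)%N -> trivial_mod (Ext C C i)].

Definition totally_reflexive C X :=
  [/\ fin_gen X, bijective (@biduality R X C),
      forall i, (0 < i)%N -> trivial_mod (Ext X C i) &
      forall i, (0 < i)%N -> trivial_mod (Ext (Hom X C) C i)].

(* 0 -> X n -> ... -> X 0 -> M -> 0 is encoded by a sequence indexed by nat
   which vanishes beyond n. *)
Definition has_GC_resolution C M (n : nat) :=
  exists (X : nat -> lmodType R) (d : forall i, {linear X i.+1 -> X i})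
         (e : {linear X 0%N -> M}),
    [/\ is_resolution d e,
        forall i, (i <= n)%N -> totally_reflexive C (X i) &
        forall i, (n < i)%N -> trivial_mod (X i)].

(* The infimum of a set of natural numbers, +oo if it is empty *)
Definition inf_nat (P : nat -> Prop) : \bar int :=
  if pselect (exists n, `[< P n >]) is left h then ((ex_minn h)%:Z)%:E else +oo%E.

Definition GC_dim C M : \bar int := inf_nat (has_GC_resolution C M).

Definition grade M : \bar int :=
  inf_nat (fun i => ~ trivial_mod (Ext M R^o i)).

Definition rgrade M C : \bar int :=
  inf_nat (fun i => (0 < i)%N /\ ~ trivial_mod (Ext M C i)).

Definition GC_perfect C M :=
  [/\ fin_gen M, GC_dim C M != +oo%E & grade M = GC_dim C M].

Definition reduced_GC_perfect C M :=
  [/\ fin_gen M, GC_dim C M != +oo%E & rgrade M C = GC_dim C M].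

Definition fin_proj_presentation M (P1 P0 : lmodType R)
    (f : {linear P1 -> P0}) (p : {linear P0 -> M}) :=
  [/\ fin_gen P1 /\ projective P1, fin_gen P0 /\ projective P0,
      forall m, exists x, p x = m &
      forall x, p x = 0 <-> exists y, f y = x].

(* Tr_C of the module presented by f : P1 -> P0 *)
Definition Tr C (P1 P0 : lmodType R) (f : {linear P1 -> P0}) : lmodType R :=
  coker (hom_pre f (N := C)).

End GC.

(* Main.v *)
From HB Require Import structures.
From Pilot Require Import Defs.
From mathcomp Require Import all_boot all_order all_algebra all_classical constructive_ereal.
From mathcomp Require Import ring.
Import Pilot.Defs.
Set Implicit Arguments.
Unset Strict Implicit.
Unset Printing Implicit Defensive.
Import GRing.Theory.
Local Open Scope ring_scope.

(* Write X^C = Hom(X, C) and let X1 -> X0 -> M -> 0 be exact with X1, X0 totally C-reflexive, with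
   T the cokernel of X0^C -> X1^C. Since X0^C and X1^C are totally reflexive and dualizing twice
   gives X1 -> X0 back, M is in turn the transpose of T for such presentations, so only
   (i) => (ii) has to be proved.
   Let N be the image of X1 -> X0. When Ext^1(M, C) = 0, T embeds into some X2^C with cokernel the
   transpose T' of N; this replaces (M, n, t) by (N, n - 1, t + 1) and keeps E = Ext^n(M, C).
   When n = 1 there is an exact sequence 0 -> E -> T -> Y -> 0 with Y totally reflexive. Hence T is,
   up to totally reflexive modules, an (n-1)st syzygy of E, which gives its dimension and its Ext's
   from those of E, with Ext^t(T, C) = Ext^(n+t-1)(E, C). Applied to E itself, the same sequences
   show that the dual Ext^m(E, C) of a G_C-perfect E of dimension m is again G_C-perfect.
   The grade, defined by Ext(-, R), can be computed from Ext(-, C): if Ext^i(E, C) is the first nonzero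
   Ext, then Hom(C, Hom(P, C)) = Hom(P, R) for P in a free resolution of E, together with
   Ext^j(C, C) = 0, gives Ext^i(E, R) = Hom(C, Ext^i(E, C)), which is nonzero because C is finite
   and faithful. *)

(** * Linear maps and exact sequences *)

Section Linear.
Variable R : comPzRingType.
Implicit Types A B D K L M N P Q U V W X : lmodType R.

Lemma linear_of A B (f : A -> B) : linear f -> exists g : {linear A -> B}, g =1 f.
Proof.
move=> lf; pose f' := f.
pose m := GRing.isLinear.Build R A B *:%R f' lf.
by exists (HB.pack_for {linear A -> B} f' m).
Qed.

(** Single-valuedness has only to be tested at 0, since two values over one [x] differ by a value
    over 0. Diagram chases define their maps this way, as graphs instead of through chosen
    preimages. *)
Lemma linear_of_rel U V (rho : U -> V -> Prop) :
  (forall a x y x' y', rho x x' -> rho y y' -> rho (a *: x + y) (a *: x' + y')) ->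
  (forall x, exists y, rho x y) -> (forall y, rho 0 y -> y = 0) ->
  exists f : {linear U -> V}, forall x y, rho x y <-> f x = y.
Proof.
move=> rl rt r0; have [f rf] := choice rt.
have ru x y : rho x y -> f x = y.
  move=> rxy; have := rl (-1) _ _ _ _ rxy (rf x).
  by rewrite scaleN1r addNr => /r0/eqP; rewrite scaleN1r addrC subr_eq0 => /eqP.
have lf : linear f by move=> a x y; apply/ru/rl.
have [g gf] := linear_of lf; exists g => x y; rewrite gf; split=> [/ru //|<-].
exact: rf.
Qed.

Definition iso U V := exists f : {linear U -> V}, bijective f.

Lemma iso_of_rel U V (rho : U -> V -> Prop) :
  (forall a x y x' y', rho x x' -> rho y y' -> rho (a *: x + y) (a *: x' + y')) ->
  (forall x, exists y, rho x y) -> (forall y, rho 0 y -> y = 0) ->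
  (forall y, exists x, rho x y) -> (forall x, rho x 0 -> x = 0) ->
  iso U V.
Proof.
move=> rl rt r0 rs ri; have [f rf] := linear_of_rel rl rt r0.
have [g rg] : exists g : {linear V -> U}, forall y x, rho x y <-> g y = x.
  by apply: linear_of_rel => // a x y x' y'; apply: rl.
exists f, g => x; first exact/rg/rf.
exact/rf/rg.
Qed.

Lemma bij_linear U V (f : {linear U -> V}) : injective f ->
  (forall v, exists u, f u = v) -> bijective f.
Proof. by move=> fi fs; have [g gK] := choice fs; exists g => // x; apply: fi. Qed.

Lemma linear_inj U V (f : {linear U -> V}) : (forall x, f x = 0 -> x = 0) -> injective f.
Proof.
by move=> fi x y /eqP; rewrite -subr_eq0 -linearB => /eqP/fi/eqP; rewrite subr_eq0 => /eqP.
Qed.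

Lemma linear_inj0 U V (f : {linear U -> V}) : injective f -> forall x, f x = 0 -> x = 0.
Proof. by move=> fi x; rewrite -(linear0 f) => /fi. Qed.

Lemma inv_linear U V (f : {linear U -> V}) : bijective f ->
  exists g : {linear V -> U}, cancel f g /\ cancel g f.
Proof.
move=> [h fK hK]; have [|g gh] := @linear_of V U h.
  by move=> a x y; apply: (can_inj fK); rewrite linearP !hK.
by exists g; split=> x; rewrite gh.
Qed.

Lemma iso_sym U V : iso U V -> iso V U.
Proof. by move=> [f /inv_linear[g [fK gK]]]; exists g, f. Qed.

Lemma trivial_iso U V : iso U V -> trivial_mod U -> trivial_mod V.
Proof. by move=> [f [g _ gK]] tU x; rewrite -(gK x) (tU (g x)) linear0. Qed.

Definition surj A B (f : A -> B) := forall b, exists a, f a = b.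

Definition right_exact A B D (f : {linear A -> B}) (g : {linear B -> D}) :=
  surj g /\ forall x, g x = 0 <-> exists y, f y = x.

Definition short_exact A B D (i : {linear A -> B}) (p : {linear B -> D}) :=
  injective i /\ right_exact i p.

Lemma right_exact0 A B D (f : {linear A -> B}) (g : {linear B -> D}) a :
  right_exact f g -> g (f a) = 0.
Proof. by move=> [_ e]; apply/e; exists a. Qed.

Lemma exact0 A B D (f : {linear A -> B}) (g : {linear B -> D}) a :
  short_exact f g -> g (f a) = 0.
Proof. by move=> [_ /right_exact0]. Qed.

Lemma factor A B D N (f : {linear A -> B}) (g : {linear B -> D}) (h : {linear B -> N}) :
  right_exact f g -> (forall a, h (f a) = 0) ->
  exists k : {linear D -> N}, forall b, k (g b) = h b.
Proof.
move=> [gs ge] hf.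
have [] := @linear_of_rel D N (fun d n => exists2 b, g b = d & h b = n).
- by move=> a x y x' y' [b <- <-] [b' <- <-]; exists (a *: b + b'); rewrite linearP.
- by move=> d; have [b <-] := gs d; exists (h b), b.
- by move=> n [b /ge[a <-] <-].
by move=> k kE; exists k => b; apply/kE; exists b.
Qed.

Lemma lift_inj A B X (i : {linear A -> B}) (h : {linear X -> B}) :
  injective i -> (forall x, exists a, i a = h x) ->
  exists k : {linear X -> A}, forall x, i (k x) = h x.
Proof.
move=> ii ih; have [] := @linear_of_rel X A (fun x a => i a = h x) => //.
- by move=> a x y x' y'; rewrite !linearP => -> ->.
- by move=> y; rewrite linear0 => /(linear_inj0 ii).
by move=> k kE; exists k => x; apply/kE.
Qed.

Lemma lift_ker A B D X (i : {linear A -> B}) (p : {linear B -> D}) (h : {linear X -> B}) :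
  short_exact i p -> (forall x, p (h x) = 0) ->
  exists k : {linear X -> A}, forall x, i (k x) = h x.
Proof. by move=> [ii [_ pe]] ph; apply: lift_inj => // x; apply/pe. Qed.

Lemma pairing X A B (f : {linear X -> A}) (g : {linear X -> B}) :
  exists h : {linear X -> (A * B)%type}, forall x, h x = (f x, g x).
Proof. by apply: linear_of => a x y; rewrite !linearP. Qed.

Lemma copairing A B X (f : {linear A -> X}) (g : {linear B -> X}) :
  exists h : {linear (A * B)%type -> X}, forall a b, h (a, b) = f a + g b.
Proof.
have [|h hE] := @linear_of (A * B)%type X (fun x => f x.1 + g x.2).
  by move=> a x y /=; rewrite !linearP scalerDr addrACA.
by exists h => a b; rewrite hE.
Qed.

Lemma short_exact_ker B D (p : {linear B -> D}) : surj p ->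
  short_exact (\val : submodule (ker p) -> B) p.
Proof.
move=> ps; split; first exact: val_inj.
split=> // x; split=> [/eqP px|[y <-]]; first by exists (Sub x px : submodule (ker p)).
exact/eqP/(valP y).
Qed.

Lemma kernel_exact B D (p : {linear B -> D}) : surj p ->
  exists K (k : {linear K -> B}), short_exact k p.
Proof. by move=> ps; eexists; eexists; exact: short_exact_ker. Qed.

Lemma im_exact A B (f : {linear A -> B}) :
  exists (I : lmodType R) (j : {linear I -> B}) (g : {linear A -> I}),
  [/\ injective j, surj g & forall a, j (g a) = f a].
Proof.
pose I := submodule (im f); pose j : {linear I -> B} := (\val : I -> B).
have ji : injective j by exact: val_inj.
have fI a : f a \in im f by apply/asboolP; exists a.
have [|g gE] := @lift_inj I B A j f ji.
  by move=> a; exists (Sub (f a) (fI a) : I).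
exists I, j, g; split=> // x.
by have /asboolP[a ax] := valP x; exists a; apply: ji; rewrite gE.
Qed.

Lemma coker_exact A B (f : {linear A -> B}) :
  right_exact f (quotmod_pi (im f) : {linear B -> coker f}).
Proof.
split=> [q|x]; first by exists (repr q); exact: quotmod_piK.
rewrite -(linear0 (quotmod_pi (im f))) (rwP eqP).
split=> [/eqP/quotmod_eq|[y <-]]; first by rewrite subr0 => /asboolP.
by apply/eqP/quotmod_eq; rewrite subr0; apply/asboolP; exists y.
Qed.

(* The cover X of B restricts to a cover W of the submodule A, with the same kernel. *)
Lemma short_exact_pull K X A B D (k : {linear K -> X}) (s : {linear X -> B})
    (i : {linear A -> B}) (p : {linear B -> D}) :
  short_exact k s -> short_exact i p ->
  exists (W : lmodType R) (w : {linear W -> X}) (q : {linear X -> D})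
    (k' : {linear K -> W}) (s' : {linear W -> A}),
  [/\ short_exact w q, short_exact k' s', forall x, q x = p (s x),
      forall x, w (k' x) = k x & forall x, i (s' x) = s (w x)].
Proof.
move=> e1 e2; have [ki [ss se]] := e1; have [ii [ps pe]] := e2.
pose q : {linear X -> D} := p \o s.
have qs : surj q by move=> d; have [b <-] := ps d; have [x <-] := ss b; exists x.
have e3 := short_exact_ker qs.
set w : {linear submodule (ker q) -> X} := (\val : submodule (ker q) -> X) in e3.
have [k' k'E] : exists k' : {linear K -> submodule (ker q)}, forall x, w (k' x) = k x.
  by apply: (lift_ker e3) => x; rewrite /q /= (exact0 _ e1) linear0.
have [s' s'E] : exists s' : {linear submodule (ker q) -> A}, forall x, i (s' x) = s (w x).
  by apply: (@lift_ker _ _ _ _ i p (s \o w) e2) => x; apply: (exact0 x e3).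
exists (submodule (ker q)), w, q, k', s'; split=> //.
split; first by move=> x y /(congr1 w); rewrite !k'E => /ki.
split=> [a|x].
  have [x xa] := ss (i a).
  have [_ [_ /(_ x)[+ _]]] := e3 => -[|y yx]; first by rewrite /q /= xa (exact0 _ e2).
  by exists y; apply: ii; rewrite s'E yx.
split=> [sx|[y <-]]; last by apply: ii; rewrite s'E k'E linear0 (exact0 _ e1).
have /se[y yx] : s (w x) = 0 by rewrite -s'E sx linear0.
by exists y; apply: (proj1 e3); rewrite k'E.
Qed.

(** [Q] is the fibre product of [X] and [X'] over [M]. Being an extension of [X'] by [K] and of [X]
    by [K'], it lets two covers of [M] be compared. *)
Lemma pullback K X K' X' M (k : {linear K -> X}) (s : {linear X -> M})
    (k' : {linear K' -> X'}) (s' : {linear X' -> M}) :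
  short_exact k s -> short_exact k' s' ->
  exists (Q : lmodType R) (q : {linear Q -> X}) (q' : {linear Q -> X'})
    (j : {linear K -> Q}) (j' : {linear K' -> Q}),
  [/\ short_exact j q', short_exact j' q, forall x, q (j x) = k x
    & forall x, q' (j' x) = k' x].
Proof.
move=> e1 e2; have [ki [ss se]] := e1; have [ki' [ss' se']] := e2.
have [d dE] : exists d : {linear (X * X')%type -> M}, forall x x', d (x, x') = s x - s' x'.
  exact: (copairing s (\- s')).
pose Q := submodule (ker d).
pose u : {linear Q -> (X * X')%type} := (\val : Q -> _).
have ui : injective u by exact: val_inj.
have uE x x' : s x = s' x' -> exists z, u z = (x, x').
  move=> xx'; have dx : (x, x') \in ker d by rewrite unfold_in /ker dE xx' subrr.
  by exists (Sub (x, x') dx).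
have uE' z : s (u z).1 = s' (u z).2.
  have : d (u z) = 0 by apply/eqP; exact: (valP z).
  by case: (u z) => x x'; rewrite dE => /eqP; rewrite subr_eq0 => /eqP.
have [q qE] : exists q : {linear Q -> X}, forall z, q z = (u z).1 by exists (fst \o u).
have [q' qE'] : exists q : {linear Q -> X'}, forall z, q z = (u z).2 by exists (snd \o u).
have [v vE] := pairing k (\0 : {linear K -> X'}).
have [v' vE'] := pairing (\0 : {linear K' -> X}) k'.
have [|j jE] := @lift_inj _ _ _ u v ui.
  by move=> x; rewrite vE; apply: uE; rewrite (exact0 _ e1) linear0.
have [|j' jE'] := @lift_inj _ _ _ u v' ui.
  by move=> x; rewrite vE'; apply: uE; rewrite (exact0 _ e2) linear0.
exists Q, q, q', j, j'; split=> [| |x|x]; rewrite ?qE ?qE' ?jE ?jE' ?vE ?vE' //.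
- split; first by move=> x y /(congr1 u); rewrite !jE !vE => -[/ki].
  split=> [x'|z]; rewrite ?qE'.
    by have [x xx'] := ss (s' x'); have [z zE] := uE _ _ xx'; exists z; rewrite qE' zE.
  split=> [z2|[y <-]]; last by rewrite jE vE.
  have := uE' z; rewrite z2 linear0 => /se[y yz]; exists y; apply: ui.
  by rewrite jE vE yz [RHS]surjective_pairing z2.
- split; first by move=> x y /(congr1 u); rewrite !jE' !vE' => -[/ki'].
  split=> [x|z]; rewrite ?qE.
    by have [x' /esym xx'] := ss' (s x); have [z zE] := uE _ _ xx'; exists z; rewrite qE zE.
  split=> [z1|[y <-]]; last by rewrite jE' vE'.
  have := uE' z; rewrite z1 linear0 => /esym/se'[y yz]; exists y; apply: ui.
  by rewrite jE' vE' yz [RHS]surjective_pairing z1.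
Qed.

Lemma coker_iso A B D A' B' D' (f : {linear A -> B}) (p : {linear B -> D})
    (f' : {linear A' -> B'}) (p' : {linear B' -> D'})
    (a : {linear A -> A'}) (b : {linear B -> B'}) :
  bijective a -> bijective b -> (forall x, b (f x) = f' (a x)) ->
  right_exact f p -> right_exact f' p' -> iso D D'.
Proof.
move=> ba [b1 bK bK'] bf [ps pe] [ps' pe']; have [a1 aK aK'] := ba.
apply: (@iso_of_rel D D' (fun d d' => exists2 x, p x = d & p' (b x) = d')).
- by move=> c x y x' y' [z <- <-] [z' <- <-]; exists (c *: z + z'); rewrite !linearP.
- by move=> d; have [x xd] := ps d; exists (p' (b x)), x.
- by move=> d' [x /pe[y <-] <-]; apply/pe'; exists (a y); rewrite bf.
- by move=> d'; have [x xd] := ps' d'; exists (p (b1 x)), (b1 x); rewrite ?bK'.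
- move=> d [x <- /pe'[y yx]]; apply/pe; exists (a1 y); apply: (can_inj bK).
  by rewrite bf aK'.
Qed.

End Linear.

(** * Projective modules and Ext *)

Section Projective.
Variable R : comPzRingType.
Implicit Types A B D K L M N P Q U V W X : lmodType R.

Definition retract U V :=
  exists (a : {linear U -> V}) (b : {linear V -> U}), forall x, b (a x) = x.

Lemma projective_prod U V : projective U -> projective V -> projective (U * V)%type.
Proof.
move=> pU pV A B g h gs.
have [i iE] := pairing (idfun : {linear U -> U}) (\0 : {linear U -> V}).
have [j jE] := pairing (\0 : {linear V -> U}) (idfun : {linear V -> V}).
have [u uE] := pU A B g (h \o i) gs; have [v vE] := pV A B g (h \o j) gs.
have [w wE] := copairing u v; exists w => -[x y].
rewrite wE linearD uE vE /= iE jE -linearD; congr (h _).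
by rewrite -[LHS]/(x + 0, 0 + y) addr0 add0r.
Qed.

Lemma projective_split P B (p : {linear B -> P}) : projective P -> surj p ->
  exists s : {linear P -> B}, forall x, p (s x) = x.
Proof. by move=> pP ps; have [s sE] := pP B P p idfun ps; exists s. Qed.

Lemma kernel_retract W P D (w : {linear W -> P}) (q : {linear P -> D}) :
  projective D -> short_exact w q -> exists r : {linear P -> W}, forall x, r (w x) = x.
Proof.
move=> pD e; have [wi [qs _]] := e; have [s sE] := projective_split pD qs.
have [|r rE] := @lift_ker _ _ _ _ _ w q (idfun \- (s \o q)) e.
  by move=> x /=; rewrite linearB sE subrr.
by exists r => x; apply: wi; rewrite rE /= (exact0 _ e) linear0 subr0.
Qed.

Lemma projective_regular : projective (R^o : lmodType R).
Proof.
move=> A B g h gs; have [a ga] := gs (h 1).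
have [|k kE] := @linear_of R R^o A (fun r => r *: a).
  by move=> r x y; rewrite scalerDl scalerA.
exists k => r; rewrite kE linearZ ga -linearZ; congr (h _); exact: mulr1.
Qed.

End Projective.

(** * Ext through projective covers and dimension shifting *)

Section Ext.
Variable R : comPzRingType.
Implicit Types A B D K L M N P Q U V W X : lmodType R.
Variable N : lmodType R.

(* isExt i M V says that V is Ext^(i+1)(M, N), computed along some chain of projective covers. *)
Fixpoint isExt (i : nat) M V : Prop :=
  exists K P (k : {linear K -> P}) (s : {linear P -> M}),
    [/\ projective P, short_exact k s &
      match i with
      | 0%N => exists phi : {linear Hom K N -> V}, right_exact (hom_pre k (N := N)) phi
      | j.+1 => isExt j K V
      end].

(** Degrees follow [isExt]: index [i] stands for the vanishing of Ext^(i+1)(M, N). *)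
Definition Ext0 i M := forall V, isExt i M V -> trivial_mod V.
Definition acyclic M := forall i, Ext0 i M.
(** This is Ext^1(M, N) = 0 without reference to a cover of [M]; see [extendsP]. *)
Definition extends M := forall A B (i : {linear A -> B}) (p : {linear B -> M}),
  short_exact i p ->
  forall g : {linear A -> N}, exists h : {linear B -> N}, forall a, h (i a) = g a.

Lemma hom_preE A B W (f : {linear A -> B}) (h : Hom B W) x :
  hom_fun (hom_pre f h) x = hom_fun h (f x).
Proof. by []. Qed.

Lemma hom_surj A B (k : {linear A -> B}) :
  (forall g : {linear A -> N}, exists h : {linear B -> N}, forall a, h (k a) = g a) ->
  surj (hom_pre k (N := N)).
Proof. by move=> e g; have [h hg] := e (hom_fun g); exists (hom_of h); apply: hom_ext. Qed.

Lemma surj_hom A B (k : {linear A -> B}) (g : {linear A -> N}) :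
  surj (hom_pre k (N := N)) -> exists h : {linear B -> N}, forall a, h (k a) = g a.
Proof.
move=> /(_ (hom_of g))[h hg]; exists (hom_fun h) => a.
by rewrite -[LHS]/(hom_fun (hom_pre k h) a) hg.
Qed.

Lemma short_exact_id M : @short_exact R 'rV[R]_0 M M \0 idfun.
Proof.
split; first by move=> x y _; apply/rowP; case.
split=> [x|x]; first by exists x.
by split=> /= [->|[y <-] //]; exists 0.
Qed.

Lemma trivial_rV0 : trivial_mod 'rV[R]_0.
Proof. by move=> x; apply/rowP; case. Qed.

Lemma projective_trivial U : trivial_mod U -> projective U.
Proof.
by move=> tU A B g h gs; exists \0 => x; rewrite (tU x) !linear0.
Qed.

Lemma isExt_iso i M V V' : iso V V' -> isExt i M V -> isExt i M V'.
Proof.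
move=> [f fb]; elim: i M => [|i IH] M [K [P [k [s [pP e]]]]] /= => [[phi [ps pe]]|kV].
  exists K, P, k, s; split=> //; exists (f \o phi); have [f' fK fK'] := fb.
  split=> [v|h]; first by have [h hE] := ps (f' v); exists h; rewrite /= hE.
  rewrite -pe; split=> /= [|->]; last by rewrite linear0.
  by move/(linear_inj0 (bij_inj fb)).
by exists K, P, k, s; split=> //; apply: IH.
Qed.

Lemma extends_projective P : projective P -> extends P.
Proof.
move=> pP A B i p e g; have [r rE] := kernel_retract pP e.
by exists (g \o r) => a /=; rewrite rE.
Qed.

(** Since [p] splits by [t], a projective cover [P] of [A] gives the projective cover [P * D] of [B]
    with the same kernel. *)
Lemma isExt_proj_l i A B D V (k : {linear A -> B}) (p : {linear B -> D}) :
  projective D -> short_exact k p -> isExt i A V -> isExt i B V.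
Proof.
move=> pD e iA; have [ki [ps pe]] := e; have [t tE] := projective_split pD ps.
have pull K P (j : {linear K -> P}) (s : {linear P -> A}) : projective P ->
   short_exact j s -> exists (P' : lmodType R) (j' : {linear K -> P'}) (s' : {linear P' -> B})
   (a : {linear P -> P'}) (b : {linear P' -> P}),
   [/\ projective P', short_exact j' s', forall x, a (j x) = j' x & forall x, b (j' x) = j x].
  move=> pP [ji [ss se]].
  have [j' jE] := pairing j (\0 : {linear K -> D}).
  have [s' sE] := copairing (k \o s) t.
  have [a aE] := pairing (idfun : {linear P -> P}) (\0 : {linear P -> D}).
  exists (P * D)%type, j', s', a, fst; split; last 2 first.
  - by move=> x; rewrite jE aE.
  - by move=> x; rewrite jE.
  - exact: projective_prod.
  split; first by move=> x y; rewrite !jE => -[/ji].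
  split=> [b|[x d]].
    have /pe[a' aE'] : p (b - t (p b)) = 0 by rewrite linearB tE subrr.
    have [x xa] := ss a'; exists (x, p b).
    by rewrite sE /= xa aE' subrK.
  rewrite sE /=; split=> [sx|[y]]; last first.
    rewrite jE /= => -[<- <-]; rewrite (_ : s (j y) = 0); last by apply/se; exists y.
    by rewrite !linear0 addr0.
  have d0 : d = 0.
    by rewrite -(tE d) -[t d](addKr (k (s x))) sx addr0 linearN (exact0 _ e) oppr0.
  move: sx; rewrite d0 linear0 addr0 => /(linear_inj0 ki)/se[y yx].
  by exists y; rewrite jE yx.
case: i iA => [|i] /= [K [P [j [s [pP e' +]]]]].
  have [P' [j' [s' [a [b [pP' e'' aE bE]]]]]] := pull _ _ _ _ pP e'.
  move=> [phi [phis phie]]; exists K, P', j', s'; split=> //; exists phi; split=> // h.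
  rewrite phie; split=> -[g gh].
    by exists (hom_pre b g); rewrite -gh; apply: hom_ext => x; rewrite !hom_preE bE.
  by exists (hom_pre a g); rewrite -gh; apply: hom_ext => x; rewrite !hom_preE aE.
have [P' [j' [s' [a [b [pP' e'' aE bE]]]]]] := pull _ _ _ _ pP e'.
by move=> iK; exists K, P', j', s'; split.
Qed.

(** Every map on [K] or [K'] extends to the pullback [Q], because Ext^1 vanishes on [X'] and [X].
    Two classes correspond when they come from restrictions of one map on [Q]. The covers need not
    be projective, so totally reflexive ones are allowed. *)
Lemma deg1_iso K X K' X' M V V' (k : {linear K -> X}) (s : {linear X -> M})
    (k' : {linear K' -> X'}) (s' : {linear X' -> M})
    (phi : {linear Hom K N -> V}) (phi' : {linear Hom K' N -> V'}) :
  short_exact k s -> short_exact k' s' -> extends X -> extends X' ->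
  right_exact (hom_pre k (N := N)) phi -> right_exact (hom_pre k' (N := N)) phi' ->
  iso V V'.
Proof.
move=> e e' xX xX' [ps pe] [ps' pe'].
have [Q [q [q' [j [j' [eq' eq qj qj']]]]]] := pullback e e'.
(* If [g] restricted to [K1] extends to [u] on [X1], then [g - u q1] vanishes on [K1] and descends
   to [X2]. There it extends the restriction of [g] to [K2], because [q1 j2 = 0]. *)
have half K1 X1 K2 X2 V1 V2 (k1 : {linear K1 -> X1}) (k2 : {linear K2 -> X2})
    (q1 : {linear Q -> X1}) (q2 : {linear Q -> X2}) (j1 : {linear K1 -> Q})
    (j2 : {linear K2 -> Q}) (f1 : {linear Hom K1 N -> V1}) (f2 : {linear Hom K2 N -> V2}) :
    (forall h, f1 h = 0 <-> exists g, hom_pre k1 g = h) ->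
    (forall h, f2 h = 0 <-> exists g, hom_pre k2 g = h) ->
    short_exact j1 q2 -> short_exact j2 q1 ->
    (forall x, q1 (j1 x) = k1 x) -> (forall x, q2 (j2 x) = k2 x) ->
    forall g : Hom Q N, f1 (hom_pre j1 g) = 0 -> f2 (hom_pre j2 g) = 0.
  move=> pe1 pe2 e12 e21 qj1 qj2 g /pe1[u uE]; apply/pe2.
  have [|h hE] := factor (h := hom_fun g \- (hom_fun u \o q1)) (proj2 e12).
    move=> x /=; rewrite -[hom_fun g _]/(hom_fun (hom_pre j1 g) x) -uE.
    by rewrite -[hom_fun (hom_pre k1 u) x]/(hom_fun u (k1 x)) qj1 subrr.
  exists (hom_of h); apply: hom_ext => x.
  rewrite -[LHS]/(h (k2 x)) -qj2 hE /= (exact0 x e21) linear0 subr0 //.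
apply: (@iso_of_rel R V V' (fun v v' =>
  exists2 g : Hom Q N, phi (hom_pre j g) = v & phi' (hom_pre j' g) = v')).
- by move=> a x y x' y' [g <- <-] [g' <- <-]; exists (a *: g + g'); rewrite !linearP.
- move=> v; have [h <-] := ps v; have [g gh] := hom_surj (xX' _ _ _ _ eq') h.
  by exists (phi' (hom_pre j' g)), g; rewrite ?gh.
- by move=> v' [g g0 <-]; exact: half pe pe' eq' eq qj qj' g g0.
- move=> v; have [h <-] := ps' v; have [g gh] := hom_surj (xX _ _ _ _ eq) h.
  by exists (phi (hom_pre j g)), g; rewrite ?gh.
- by move=> v [g <- g0]; exact: half pe' pe eq eq' qj' qj g g0.
Qed.

(** Schanuel's argument: the pullback of two projective covers is an extension of a projective
    module by either kernel, so [isExt_proj_l] carries both computations over to [Q]. *)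
Lemma isExt_uniq i M V V' : isExt i M V -> isExt i M V' -> iso V V'.
Proof.
elim: i M => [|i IH] M [K [P [k [s [pP e +]]]]] [K' [P' [k' [s' [pP' e' +]]]]].
  move=> [phi x] [phi' x']; apply: deg1_iso e e' _ _ x x'; exact: extends_projective.
have [Q [q [q' [j [j' [eq' eq _ _]]]]]] := pullback e e'.
move=> iK iK'; apply: (IH Q); first exact: isExt_proj_l eq' iK.
exact: isExt_proj_l eq iK'.
Qed.

Lemma free_cover_exact K :
  short_exact (\val : submodule (ker (free_cover K)) -> free R K) (free_cover K).
Proof. apply: short_exact_ker; exact: cover_surj. Qed.

(** Here [S] is the image of [pr_d P j]. Cocycles of degree [j.+1] are the maps that factor through
    [S], and coboundaries those that moreover extend along [i], so cohomology is the cokernel of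
    restriction to [S]. *)
Lemma Ext_res_right_exact M (P : proj_resolution M) j (S : lmodType R)
    (i : {linear S -> pr_mod P j}) (c : {linear pr_mod P j.+1 -> S}) :
  surj c -> (forall x, i (c x) = pr_d P j x) ->
  (forall x, c x = 0 <-> exists y, pr_d P j.+1 y = x) ->
  exists phi : {linear Hom S N -> Ext_res N P j.+1}, right_exact (hom_pre i (N := N)) phi.
Proof.
move=> cs ic ce.
pose Z := cocycles N P j.+1; pose B := coboundaries N P j.+1.
pose v : {linear submodule Z -> Hom (pr_mod P j.+1) N} := \val.
have vi : injective v by exact: val_inj.
have [|d dE] := @lift_inj R _ _ _ v (hom_pre c (N := N)) vi.
  move=> g; suff gZ : hom_pre c g \in Z by exists (Sub (hom_pre c g) gZ).
  apply/eqP/hom_ext => x; have c0 : c (pr_d P j.+1 x) = 0 by apply/ce; exists x.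
  by rewrite !hom_preE c0 linear0.
pose q : {linear submodule Z -> Ext_res N P j.+1} := quotmod_pi (preim_of v B).
have q0 z : q z = 0 <-> exists h : Hom (pr_mod P j) N, hom_pre (pr_d P j) h = v z.
  rewrite -(linear0 q); split=> [/quotmod_eq|[h hE]].
    by rewrite subr0 => /asboolP.
  by apply/quotmod_eq; rewrite subr0; apply/asboolP; exists h.
exists (q \o d); split=> [w|g].
  rewrite -[w]quotmod_piK -/q; move: (repr w) => z.
  have zZ : hom_pre (pr_d P j.+1) (v z) = 0 by apply/eqP; exact: (valP z).
  have [||g gE] := @factor R _ _ _ N (pr_d P j.+1) c (hom_fun (v z)); first by split.
    by move=> x; exact: (congr1 (fun f => hom_fun f x) zZ).
  by exists (hom_of g); congr (q _); apply: vi; rewrite dE; apply: hom_ext => x; exact: gE.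
rewrite /= q0; split=> -[h hE]; exists h.
  apply: hom_ext => x; have [y <-] := cs x.
  rewrite hom_preE ic; have := congr1 (fun f => hom_fun f y) hE; rewrite dE; exact.
by rewrite dE -hE; apply: hom_ext => x; rewrite !hom_preE ic.
Qed.

Definition syz_incl M j : {linear syzygy M j.+1 -> std_mod M j} :=
  (\val : submodule (ker (free_cover (syzygy M j))) -> free R (syzygy M j)).

Lemma syz_exact M j : short_exact (syz_incl M j) (free_cover (syzygy M j)).
Proof. exact: free_cover_exact. Qed.

Lemma Ext_right_exact M j :
  exists phi : {linear Hom (syzygy M j.+1) N -> Ext M N j.+1},
    right_exact (hom_pre (syz_incl M j) (N := N)) phi.
Proof.
apply: (@Ext_res_right_exact M (std_resolution M) j _ _ (free_cover (syzygy M j.+1))).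
- exact: cover_surj.
- by [].
- exact: std_exact.
Qed.

Lemma isExt_Ext i M : isExt i M (Ext M N i.+1).
Proof.
suff H j : isExt i (syzygy M j) (Ext M N (i + j).+1) by move: (H 0%N); rewrite addn0.
elim: i j => [|i IH] j; exists (syzygy M j.+1), (std_mod M j), (syz_incl M j),
    (free_cover (syzygy M j)); split.
- exact: free_projective.
- exact: syz_exact.
- exact: Ext_right_exact.
- exact: free_projective.
- exact: syz_exact.
- by rewrite addSnnS; exact: IH.
Qed.

Lemma isExt_Ext_iso i M V : isExt i M V <-> iso (Ext M N i.+1) V.
Proof.
split=> [|/isExt_iso]; first by apply: isExt_uniq; exact: isExt_Ext.
apply; exact: isExt_Ext.
Qed.

Lemma Ext0P i M : Ext0 i M <-> trivial_mod (Ext M N i.+1).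
Proof.
split=> [|tM V /isExt_Ext_iso /trivial_iso]; last exact.
apply; exact: isExt_Ext.
Qed.

Lemma extendsP M : Ext0 0 M <-> extends M.
Proof.
have [K [P [k [s [pP e [phi [ps pe]]]]]]] := isExt_Ext 0 M; rewrite Ext0P.
split=> [t|xM v]; last first.
  have [h <-] := ps v; apply/pe.
  exact: (hom_surj (xM _ _ _ _ e)).
move=> A B i p ex g; have [ii [psu pex]] := ex.
have [l lE] := pP B M p s psu.
have [|m mE] := @lift_ker _ _ _ _ _ i p (l \o k) ex.
  by move=> x /=; rewrite lE (exact0 _ e).
have [h hE] : exists h : {linear P -> N}, forall x, h (k x) = g (m x).
  apply: (@surj_hom _ _ k (g \o m)) => u; apply/pe; exact: t.
(* [B] is the sum of [l P] and [i A], and the extension must send [l x + i a] to [h x + g a]. It is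
   well defined because [l x + i a = 0] puts [x] in [K], where [h] agrees with [g m]. *)
have [] := @linear_of_rel R B N (fun b n => exists x a, b = l x + i a /\ n = h x + g a).
- move=> c b b' n n' [x [a [-> ->]]] [x' [a' [-> ->]]].
  exists (c *: x + x'), (c *: a + a'); rewrite !linearP /= !scalerDr.
  by split; rewrite addrACA.
- move=> b; have [x xb] := proj1 (proj2 e) (p b).
  have /pex[a aE] : p (b - l x) = 0 by rewrite linearB lE xb subrr.
  by exists (h x + g a), x, a; rewrite aE addrC subrK.
- move=> n [x [a [/esym xa ->]]].
  have /(proj2 (proj2 e))[y yx] : s x = 0.
    by rewrite -lE -[l x](addrK (i a)) xa sub0r linearN (exact0 _ ex) oppr0.
  rewrite -yx hE -linearD (_ : m y + a = 0) ?linear0 //.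
  by apply: (linear_inj0 ii); rewrite linearD mE /= yx.
move=> f fE; exists f => a; apply/fE; exists 0, a.
by rewrite !linear0 !add0r.
Qed.

Lemma isExt0_extends K X M V (k : {linear K -> X}) (s : {linear X -> M})
    (phi : {linear Hom K N -> V}) :
  short_exact k s -> extends X -> right_exact (hom_pre k (N := N)) phi -> isExt 0 M V.
Proof.
move=> e xX r; have := isExt_Ext 0 M; have [K' [P [k' [s' [pP e' [psi r']]]]]] := isExt_Ext 0 M.
apply: isExt_iso; apply: deg1_iso e' e _ xX r' r; exact: extends_projective.
Qed.

Lemma acyclic_projective P : projective P -> acyclic P.
Proof.
move=> pP [|i]; first exact/extendsP/extends_projective.
move=> V /isExt_uniq; have t : isExt i.+1 P 'rV[R]_0.
  exists 'rV[R]_0, P, \0, idfun; split=> //; first exact: short_exact_id.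
  elim: i => [|i IH]; exists 'rV[R]_0, 'rV[R]_0, \0, idfun.
    split; [exact: projective_trivial trivial_rV0|exact: short_exact_id|].
    exists \0; split=> [v|h]; first by exists 0; apply/rowP; case.
    split=> // _; exists 0; apply: hom_ext => x.
    by rewrite (trivial_rV0 x) !linear0.
  by split; [exact: projective_trivial trivial_rV0|exact: short_exact_id|].
by move=> /(_ _ t) /iso_sym /trivial_iso; apply; exact: trivial_rV0.
Qed.

Lemma acyclic_ker W P D (w : {linear W -> P}) (q : {linear P -> D}) :
  short_exact w q -> projective P -> acyclic D -> acyclic W.
Proof. by move=> e pP aD i V iV; apply: (aD i.+1); exists W, P, w, q. Qed.

(** The two claims feed each other. The first in degree [i] gives the second, by pulling an acyclic
    cover of [M] back along a free one. The second in degree [i] gives the first in degree [i.+1]: a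
    cover of [B] restricts to a cover of [A] by a module [W] which is again acyclic. *)
Lemma isExt_acyclic i :
  (forall A B D V (k : {linear A -> B}) (p : {linear B -> D}),
    short_exact k p -> acyclic D -> isExt i B V -> isExt i A V) /\
  (forall K X M V (k : {linear K -> X}) (s : {linear X -> M}),
    short_exact k s -> acyclic X -> isExt i K V -> isExt i.+1 M V).
Proof.
have shift j :
  (forall A B D V (k : {linear A -> B}) (p : {linear B -> D}),
    short_exact k p -> acyclic D -> isExt j B V -> isExt j A V) ->
  (forall K X M V (k : {linear K -> X}) (s : {linear X -> M}),
    short_exact k s -> acyclic X -> isExt j K V -> isExt j.+1 M V).
  move=> H K X M V k s e aX iK; pose e' := free_cover_exact M.
  have [Q [q [q' [l [l' [eq' eq _ _]]]]]] := pullback e e'.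
  exists (submodule (ker (free_cover M))), (free R M),
    (\val : submodule (ker (free_cover M)) -> free R M), (free_cover M).
  split=> //; first exact: free_projective.
  apply: H eq aX _; apply: isExt_proj_l eq' iK; exact: free_projective.
have pull A B D K P (j : {linear A -> B}) (p : {linear B -> D}) (k : {linear K -> P})
    (s : {linear P -> B}) : short_exact k s -> short_exact j p -> projective P -> acyclic D ->
    exists (W : lmodType R) (w : {linear W -> P}) (k' : {linear K -> W}) (s' : {linear W -> A}),
    [/\ short_exact k' s', acyclic W, forall x, w (k' x) = k x & surj (hom_pre w (N := N))].
  move=> e1 e2 pP aD; have [W [w [q [k' [s' [ew ek _ wk _]]]]]] := short_exact_pull e1 e2.
  exists W, w, k', s'; split=> //; first exact: acyclic_ker ew pP aD.
  apply: hom_surj; have xD : extends D by apply/extendsP; exact: (aD 0%N).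
  exact: xD ew.
elim: i => [|i [_ IH]].
  suff H A B D V (k : {linear A -> B}) (p : {linear B -> D}) :
    short_exact k p -> acyclic D -> isExt 0 B V -> isExt 0 A V by split=> //; exact: shift.
  move=> e aD [K [P [l [s [pP el [phi [phis phie]]]]]]].
  have [W [w [k' [s' [ek aW wk ws]]]]] := pull _ _ _ _ _ _ _ _ _ el e pP aD.
  apply: (isExt0_extends (phi := phi) ek); first by apply/extendsP; exact: (aW 0%N).
  split=> // h; rewrite phie; split=> -[g <-].
    by exists (hom_pre w g); apply: hom_ext => x; rewrite !hom_preE wk.
  have [f <-] := ws g.
  by exists f; apply: hom_ext => x; rewrite !hom_preE wk.
suff H A B D V (k : {linear A -> B}) (p : {linear B -> D}) :
  short_exact k p -> acyclic D -> isExt i.+1 B V -> isExt i.+1 A V by split=> //; exact: shift.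
move=> e aD [K [P [l [s [pP el iK]]]]].
have [W [w [k' [s' [ek aW wk ws]]]]] := pull _ _ _ _ _ _ _ _ _ el e pP aD.
exact: IH ek aW iK.
Qed.

Lemma isExt_acyclic_quot i A B D V (k : {linear A -> B}) (p : {linear B -> D}) :
  short_exact k p -> acyclic D -> isExt i A V <-> isExt i B V.
Proof.
move=> e aD; have H := proj1 (isExt_acyclic i) _ _ _ _ _ _ e aD.
split=> [iA|]; last exact: H.
apply: isExt_iso (isExt_Ext i B); exact: isExt_uniq (H _ (isExt_Ext i B)) iA.
Qed.

Lemma isExt_shift i K X M V (k : {linear K -> X}) (s : {linear X -> M}) :
  short_exact k s -> acyclic X -> isExt i K V <-> isExt i.+1 M V.
Proof.
move=> e aX; have H := proj2 (isExt_acyclic i) _ _ _ _ _ _ e aX.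
split=> [|iM]; first exact: H.
apply: isExt_iso (isExt_Ext i K); exact: isExt_uniq (H _ (isExt_Ext i K)) iM.
Qed.

(** Degree 0 is out of reach of [isExt]; left exactness of Hom identifies the cocycles there with
    Hom(M, N). *)
Lemma trivial_Ext_res0 M (P : proj_resolution M) :
  trivial_mod (Ext_res N P 0) <-> trivial_mod (Hom M N).
Proof.
have [es e0 _] := pr_res P; have re : right_exact (pr_d P 0) (pr_e P) by split.
pose Z := cocycles N P 0; pose B := coboundaries N P 0.
pose v : {linear submodule Z -> Hom (pr_mod P 0) N} := \val.
pose q : {linear submodule Z -> Ext_res N P 0} := quotmod_pi (preim_of v B).
split=> [t h|t w].
  have hZ : hom_pre (pr_e P) h \in Z.
    by apply/eqP/hom_ext => x; rewrite !hom_preE (right_exact0 x re) linear0.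
  have : q (Sub (hom_pre (pr_e P) h) hZ) = q 0 by rewrite (t (q _)) (t (q 0)).
  move/quotmod_eq; rewrite subr0 => /eqP h0; apply: hom_ext => x; have [y <-] := es x.
  exact: (congr1 (fun f => hom_fun f y) h0).
rewrite -[w]quotmod_piK -/q; move: (repr w) => z.
suff -> : z = 0 by rewrite linear0.
apply: val_inj; apply: hom_ext => x.
have zZ : hom_pre (pr_d P 0) (v z) = 0 by apply/eqP; exact: (valP z).
have [y|g gE] := factor (h := hom_fun (v z)) re.
  exact: (congr1 (fun f => hom_fun f y) zZ).
by rewrite -[LHS]gE -[LHS]/(hom_fun (hom_of g) _) (t (hom_of g)).
Qed.

End Ext.

(** * Finite modules *)

Section FinGen.
Variable R : comPzRingType.
Implicit Types A B D K L M N P Q U V W X : lmodType R.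

Lemma fin_gen_surj A B (p : {linear A -> B}) : surj p -> fin_gen A -> fin_gen B.
Proof.
move=> ps [k [g gE]]; exists k, (p \o g) => b.
have [a <-] := ps b; have [c ->] := gE a; exists c.
by rewrite linear_sum; apply: eq_bigr => i _; rewrite linearZ.
Qed.

Lemma fin_gen_ext A B D (i : {linear A -> B}) (p : {linear B -> D}) :
  short_exact i p -> fin_gen A -> fin_gen D -> fin_gen B.
Proof.
move=> [ii [ps pe]] [k [g gE]] [l [h hE]]; have [h' h'E] := choice (fun j => ps (h j)).
exists (k + l)%N, (fun j : 'I_(k + l) =>
  match fintype.split j with inl a => i (g a) | inr b => h' b end) => b.
have [c cE] := hE (p b).
have /pe[a aE] : p (b - \sum_j c j *: h' j) = 0.
  rewrite linearB {1}cE linear_sum; apply/eqP; rewrite subr_eq0; apply/eqP.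
  by apply: eq_bigr => j _; rewrite linearZ h'E.
have [d dE] := gE a.
exists (fun j : 'I_(k + l) => match fintype.split j with inl a => d a | inr b => c b end).
rewrite big_split_ord -[LHS](subrK (\sum_j c j *: h' j)) -aE dE linear_sum /=.
congr (_ + _); apply: eq_bigr => j _.
  by rewrite (unsplitK (inl j)) linearZ.
by rewrite (unsplitK (inr j)).
Qed.

Fixpoint power (C : lmodType R) (k : nat) : lmodType R :=
  if k is k'.+1 then ((C * power C k')%type : lmodType R) else 'rV[R]_0.

Lemma short_exact_prod A B :
  exists (i : {linear A -> (A * B)%type}) (p : {linear (A * B)%type -> B}), short_exact i p.
Proof.
have [i iE] := pairing (idfun : {linear A -> A}) (\0 : {linear A -> B}).
exists i, snd; split; first by move=> x y; rewrite !iE => -[].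
split=> [b|[x y]]; first by exists (0, b).
by split=> /= [->|[z]]; [exists x; rewrite iE|rewrite iE => -[_ <-]].
Qed.

Lemma ideal_fin_gen (I : lmodType R) (j : {linear I -> R^o}) :
  noetherian R -> injective j -> fin_gen I.
Proof.
move=> nR ji; pose v : {linear submodule (im j) -> R^o} := \val.
have [|u uE] := @lift_inj R I R^o (submodule (im j)) j v ji.
  by move=> x; apply/asboolP; exact: (valP x).
apply: (fin_gen_surj (p := u)) (nR (im j)) => x.
have jx : j x \in im j by apply/asboolP; exists x.
by exists (Sub (j x) jx : submodule (im j)); apply: ji; rewrite uE.
Qed.

(** Induct on [k]: the first coordinate maps [A] onto an ideal, and the kernel embeds into the
    remaining coordinates. *)
Lemma power_noetherian k A (i : {linear A -> power R^o k}) :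
  noetherian R -> injective i -> fin_gen A.
Proof.
move=> nR; elim: k A i => [|k IH] A i ii.
  exists 0%N, (fun=> 0) => x; exists (fun=> 0); rewrite big_ord0.
  by apply: ii; apply/rowP; case.
have [I [j [g [ji gs jg]]]] := im_exact (fst \o i : {linear A -> R^o}).
have e := short_exact_ker gs.
apply: (fin_gen_ext e); last exact: ideal_fin_gen ji.
pose w : {linear submodule (ker g) -> A} := \val.
apply: (IH _ (snd \o (i \o w))) => x y /= xy; apply: val_inj; apply: ii.
rewrite [LHS]surjective_pairing [RHS]surjective_pairing; congr (_, _); last exact: xy.
by rewrite -[LHS]jg -[RHS]jg (exact0 x e) (exact0 y e).
Qed.

Lemma power_cover k A (g : 'I_k -> A) :
  exists p : {linear power R^o k -> A}, forall c : 'I_k -> R, exists x, p x = \sum_i c i *: g i.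
Proof.
elim: k g => [|k IH] g; first by exists \0 => c; exists 0; rewrite big_ord0.
have [p pE] := IH (fun i => g (lift ord0 i)).
have [|q qE] := @linear_of R R^o A (fun r => r *: g ord0).
  by move=> a x y; rewrite scalerDl scalerA.
have [s sE] := copairing q p; exists s => c.
have [x xE] := pE (fun i => c (lift ord0 i)); exists (c ord0, x).
by rewrite sE qE xE big_ord_recl.
Qed.

Lemma fin_gen_cover A : fin_gen A -> exists k (p : {linear power R^o k -> A}), surj p.
Proof.
move=> [k [g gE]]; have [p pE] := power_cover g; exists k, p => a.
by have [c ->] := gE a; exact: pE.
Qed.

(** The preimage of [A] in a finite free cover of [B] is finitely generated and maps onto [A]. *)
Lemma fin_gen_sub A B (i : {linear A -> B}) :
  noetherian R -> injective i -> fin_gen B -> fin_gen A.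
Proof.
move=> nR ii /fin_gen_cover[k [p ps]].
pose q : {linear B -> coker i} := quotmod_pi (im i).
pose w : {linear submodule (ker (q \o p)) -> power R^o k} := \val.
have ie := coker_exact i.
have [|u uE] := @lift_inj R A B _ i (p \o w) ii.
  by move=> x; apply/(proj2 ie)/eqP; exact: (valP x).
have wi : injective w by exact: val_inj.
apply: (fin_gen_surj (p := u)) (power_noetherian nR wi) => a.
have [x xa] := ps (i a).
have qx : x \in ker (q \o p).
  by apply/eqP; rewrite /= xa; exact: (right_exact0 a ie).
by exists (Sub x qx : submodule (ker (q \o p))); apply: ii; rewrite uE.
Qed.

Lemma fin_gen_trivial A : trivial_mod A -> fin_gen A.
Proof.
by move=> tA; exists 0%N, (fun=> 0) => x; exists (fun=> 0); rewrite big_ord0 (tA x).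
Qed.

Lemma fin_gen_power C k : fin_gen C -> fin_gen (power C k).
Proof.
move=> fC; elim: k => [|k IH]; first exact/fin_gen_trivial/trivial_rV0.
by have [i [p e]] := short_exact_prod C (power C k); exact: fin_gen_ext e fC IH.
Qed.

Lemma eval_power A C k (g : 'I_k -> A) :
  exists ev : {linear Hom A C -> power C k}, forall h, ev h = 0 -> forall i, hom_fun h (g i) = 0.
Proof.
elim: k g => [|k IH] g; first by exists \0 => h _ [].
have [ev evE] := IH (fun i => g (lift ord0 i)).
have [e eE] := pairing (eval_at (C := C) (g ord0)) ev; exists e => h.
rewrite eE => -[h0 /evE h1] i; case: (unliftP ord0 i) => [j ->|-> //]; exact: h1.
Qed.

(** Evaluation at the generators of [A] embeds Hom(A, C) into a finite power of [C]. *)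
Lemma fin_gen_Hom A C : noetherian R -> fin_gen A -> fin_gen C -> fin_gen (Hom A C).
Proof.
move=> nR [k [g gE]] fC; have [ev evE] := eval_power C g.
apply: (fin_gen_sub (i := ev) nR _ (fin_gen_power k fC)).
apply: linear_inj => h /evE hg; apply: hom_ext => x; have [c ->] := gE x.
rewrite !linear_sum; apply: eq_bigr => i _.
by rewrite [LHS]linearZ [RHS]linearZ; congr (_ *: _); exact: hg.
Qed.

Lemma fin_gen_projective_retract P : fin_gen P -> projective P -> exists k, retract P (power R^o k).
Proof.
move=> /fin_gen_cover[k [p ps]] pP; have [s sE] := projective_split pP ps.
by exists k, s, p.
Qed.

End FinGen.

(** * Totally reflexive modules and G_C-dimension *)

Section TotallyReflexive.
Variable R : comPzRingType.
Implicit Types A B D K L M N P Q U V W X : lmodType R.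
Variable C : lmodType R.

(* The kernel of a cover of U is a retract of the kernel of a suitable cover of V. *)
Lemma retract_cover U V K P K' P' (k : {linear K -> P}) (s : {linear P -> U})
    (k' : {linear K' -> P'}) (s' : {linear P' -> V}) :
  retract U V -> short_exact k s -> short_exact k' s' -> projective P' ->
  exists (L : lmodType R) (l : {linear L -> (P * P')%type}) (t : {linear (P * P')%type -> V})
    (u : {linear K -> L}) (v : {linear L -> K}),
  [/\ short_exact l t, forall x, v (u x) = x & forall x, l (u x) = (k x, 0)].
Proof.
move=> [a [b ab]] e e' pP'; have [ki [ss se]] := e; have [ki' [ss' se']] := e'.
have [t tE] := copairing (a \o s) s'.
have ts : surj t by move=> y; have [x <-] := ss' y; exists (0, x); rewrite tE linear0 add0r.
have [m mE] := pP' _ _ s (b \o s') ss.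
have et := short_exact_ker ts.
pose l : {linear submodule (ker t) -> (P * P')%type} := \val.
have [n nE] := copairing (idfun : {linear P -> P}) m.
have [i iE] := pairing k (\0 : {linear K -> P'}).
have [|u uE] := @lift_ker R _ _ _ K l t i et.
  by move=> x; rewrite iE tE /= (exact0 _ e) !linear0 addr0.
have [|v vE] := @lift_ker R _ _ _ _ k s (n \o l) e.
  move=> x; have : t (l x) = 0 := exact0 x et; rewrite -[X in s X]/(n (l x)); case: (l x) => y z.
  rewrite tE nE linearD mE /= => /(congr1 b).
  by rewrite linearD linear0 /= ab.
exists (submodule (ker t)), l, t, u, v; split=> // x; last by rewrite uE iE.
by apply: ki; rewrite vE -[LHS]/(n (l (u x))) uE iE nE linear0 addr0.
Qed.

(** By [retract_cover] the retraction passes to kernels of covers, which lowers the degree. In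
    degree one, a map on [K] is composed with [v], extended from [L] to [P * P'], and restricted to
    [P]. *)
Lemma Ext0_retract i U V : retract U V -> Ext0 C i V -> Ext0 C i U.
Proof.
have [K' [P' [k' [s' [pP' e' _]]]]] := isExt_Ext C 0 V.
elim: i U V K' P' k' s' pP' e' => [|i IH] U V K' P' k' s' pP' e' r tV W [K [P [k [s [pP e iW]]]]].
all: have [L [l [t [u [v [el vu lu]]]]]] := retract_cover r e e' pP'.
  have [phi [phis phie]] := iW => w; have [h <-] := phis w; apply/phie.
  have [g gE] := (extendsP C V).1 tV _ _ _ _ el (hom_fun h \o v).
  have [i iE] := pairing (idfun : {linear P -> P}) (\0 : {linear P -> P'}).
  exists (hom_of (g \o i)); apply: hom_ext => x.
  by rewrite hom_preE -[LHS]/(g (i (k x))) iE /= -lu gE /= vu.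
have [K2 [P2 [k2 [s2 [pP2 e2 _]]]]] := isExt_Ext C 0 L.
apply: (IH K L _ _ _ _ pP2 e2) iW; first by exists u, v.
move=> Y iY; apply: tV; exists L, (P * P')%type, l, t; split=> //.
exact: projective_prod.
Qed.

Lemma acyclic_retract U V : retract U V -> acyclic C V -> acyclic C U.
Proof. by move=> r aV i; exact: Ext0_retract r (aV i). Qed.

Lemma acyclic_quot A B D (i : {linear A -> B}) (p : {linear B -> D}) :
  short_exact i p -> acyclic C D -> acyclic C A <-> acyclic C B.
Proof.
move=> e aD; split=> a j V /(isExt_acyclic_quot _ _ e aD); exact: a.
Qed.

(** Beyond degree one, Ext of [D] is Ext of [A] one degree lower; only Ext^1 has to be assumed to
    vanish. *)
Lemma acyclic_coker A B D (i : {linear A -> B}) (p : {linear B -> D}) :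
  short_exact i p -> acyclic C A -> acyclic C B -> extends C D -> acyclic C D.
Proof.
move=> e aA aB /extendsP xD [//|j] V /(isExt_shift _ _ e aB); exact: aA.
Qed.

Lemma acyclicP X : acyclic C X <-> forall i, (0 < i)%N -> trivial_mod (Ext X C i).
Proof. by split=> [a [//|i] _|a i]; [apply/Ext0P|apply/Ext0P/a]. Qed.

Local Notation TR := (totally_reflexive C).
Local Notation bid := (@biduality R _ C).

Lemma bidE X x (h : Hom X C) : hom_fun (bid x) h = hom_fun h x.
Proof. by []. Qed.

Lemma bid_linear X : linear (@biduality R X C).
Proof. by move=> a x y; apply: hom_ext => h; rewrite bidE linearP. Qed.

Lemma biduality_bij X : bijective (@biduality R X C) <->
  (forall x, (forall h : Hom X C, hom_fun h x = 0) -> x = 0) /\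
  (forall P : Hom (Hom X C) C, exists x, forall h, hom_fun P h = hom_fun h x).
Proof.
have [b bE] := linear_of (@bid_linear X); split=> [bb|[bi bs]].
  split=> [x x0|P]; last first.
    by have [g _ gK] := bb; exists (g P) => h; rewrite -[in LHS](gK P).
  apply: (bij_inj bb); apply: hom_ext => h; rewrite !bidE x0 linear0 //.
rewrite -(funext bE); apply: bij_linear => [|P].
  apply: linear_inj => x; rewrite bE => x0; apply: bi => h.
  by rewrite -bidE x0.
by have [x xP] := bs P; exists x; rewrite bE; apply: hom_ext => h; rewrite xP.
Qed.

Lemma dual_left_exact A B D (i : {linear A -> B}) (p : {linear B -> D}) : right_exact i p ->
  injective (hom_pre p (N := C)) /\
  forall h, hom_pre i (N := C) h = 0 <-> exists g, hom_pre p g = h.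
Proof.
move=> e; have [ps pe] := e; split=> [g h gh|h].
  by apply: hom_ext => d; have [b <-] := ps d; rewrite -!hom_preE gh.
split=> [h0|[g <-]]; last first.
  by apply: hom_ext => a; rewrite !hom_preE (right_exact0 _ e) linear0.
have [a|k kE] := factor (h := hom_fun h) e; first exact: (congr1 (fun f => hom_fun f a) h0).
by exists (hom_of k); apply: hom_ext => b; exact: kE.
Qed.

Lemma dual_exact A B D (i : {linear A -> B}) (p : {linear B -> D}) :
  short_exact i p -> extends C D -> short_exact (hom_pre p (N := C)) (hom_pre i (N := C)).
Proof.
move=> e xD; have [pi pe] := dual_left_exact (proj2 e).
by split=> //; split=> //; apply: hom_surj; exact: xD e.
Qed.

Lemma dual_retract A B : retract A B -> retract (Hom A C) (Hom B C).
Proof.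
move=> [a [b ab]]; exists (hom_pre b (N := C)), (hom_pre a (N := C)) => h.
by apply: hom_ext => x; rewrite !hom_preE ab.
Qed.

Lemma iso_retract A B : iso A B -> retract A B.
Proof. by move=> [f /inv_linear[g [fK _]]]; exists f, g. Qed.

Lemma totally_reflexive_retract A B : retract A B -> TR B -> TR A.
Proof.
move=> r [fB /biduality_bij[bi bs] /acyclicP aB /acyclicP aB'].
have [a [b ab]] := r; split.
- by apply: (fin_gen_surj (p := b)) fB => x; exists (a x).
- apply/biduality_bij; split=> [x x0|P].
    by rewrite -(ab x) (_ : a x = 0) ?linear0 //; apply: bi => h; exact: (x0 (hom_pre a h)).
  have [y yE] := bs (hom_pre (hom_pre a (N := C)) P); exists (b y) => h.
  rewrite -[RHS](yE (hom_pre b h)) hom_preE; congr (hom_fun P _).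
  by apply: hom_ext => x; rewrite !hom_preE ab.
- exact/acyclicP/(acyclic_retract r).
- exact/acyclicP/(acyclic_retract (dual_retract r)).
Qed.

Lemma totally_reflexive_iso A B : iso A B -> TR A -> TR B.
Proof. by move=> /iso_sym/iso_retract; exact: totally_reflexive_retract. Qed.

Lemma totally_reflexive_acyclic A : TR A -> acyclic C A.
Proof. by case=> _ _ /acyclicP. Qed.

Lemma totally_reflexive_extends A : TR A -> extends C A.
Proof. by move=> /totally_reflexive_acyclic/(_ 0%N)/extendsP. Qed.

Hypotheses (nR : noetherian R) (fC : fin_gen C).

Lemma totally_reflexive_dual A : TR A -> TR (Hom A C).
Proof.
move=> rA; have [fA bA /acyclicP aA /acyclicP aA'] := rA; split.
- exact: fin_gen_Hom.
- have [bi bs] := (biduality_bij A).1 bA; apply/biduality_bij; split=> [h h0|P].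
    by apply: hom_ext => x; exact: (h0 (bid x)).
  have [b bE] := linear_of (@bid_linear A); exists (hom_pre b (hom_of (hom_fun P))) => Q.
  have [x xQ] := bs Q; rewrite xQ hom_preE bE.
  by congr (hom_fun P _); apply: hom_ext => h; rewrite xQ.
- exact/acyclicP.
- apply/acyclicP; apply: acyclic_retract aA; apply: iso_retract; apply: iso_sym.
  have [b bE] := linear_of (@bid_linear A); exists b; by rewrite (funext bE).
Qed.

Lemma totally_reflexive_trivial A : trivial_mod A -> TR A.
Proof.
move=> tA; have tD : trivial_mod (Hom A C).
  by move=> h; apply: hom_ext => x; rewrite (tA x) !linear0.
have tDD : trivial_mod (Hom (Hom A C) C).
  by move=> h; apply: hom_ext => x; rewrite (tD x) !linear0.
split; [exact: fin_gen_trivial| |exact/acyclicP/acyclic_projective/projective_trivial..].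
by exists (fun=> 0) => x; rewrite ?(tA x) // [LHS]tDD [RHS]tDD.
Qed.

Lemma totally_reflexive_mid A B D (i : {linear A -> B}) (p : {linear B -> D}) :
  short_exact i p -> TR A -> TR D -> TR B.
Proof.
move=> e rA rD; have [fA /biduality_bij[biA bsA] /acyclicP aA /acyclicP aA'] := rA.
have [fD /biduality_bij[biD bsD] /acyclicP aD /acyclicP aD'] := rD.
have xD := totally_reflexive_extends rD; have e' := dual_exact e xD.
have [ii [ps pe]] := e; split.
- exact: fin_gen_ext e fA fD.
- apply/biduality_bij; split=> [b b0|P].
    have /pe[a ab] : p b = 0 by apply: biD => h; exact: (b0 (hom_pre p h)).
    rewrite -ab (_ : a = 0) ?linear0 //; apply: biA => h.
    have [g gE] := xD _ _ _ _ e (hom_fun h).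
    by rewrite -gE ab; exact: (b0 (hom_of g)).
  (* On maps factoring through [p], [P] is evaluation at [d = p b]. Hence [P] minus evaluation at
     [b] factors through the dual of [A], where it is evaluation at some [a], and [P] is evaluation
     at [b + i a]. *)
  have [d dE] := bsD (hom_pre (hom_pre p (N := C)) P); have [b bd] := ps d.
  have [b' b'E] := linear_of (@bid_linear B).
  have [h|S SE] := factor (h := hom_fun P \- hom_fun (b' b)) (proj2 e').
    by rewrite /= b'E bidE hom_preE bd -dE hom_preE subrr.
  have [a aE] := bsA (hom_of S); exists (b + i a) => h.
  have /eqP := SE h; rewrite /= b'E bidE eq_sym subr_eq => /eqP ->.
  by rewrite linearD addrC; congr (_ + _); exact: (aE (hom_pre i h)).
- exact/acyclicP/(acyclic_quot e aD).
- exact/acyclicP/(acyclic_quot e' aA').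
Qed.

Lemma totally_reflexive_ker A B D (i : {linear A -> B}) (p : {linear B -> D}) :
  short_exact i p -> TR B -> TR D -> TR A.
Proof.
move=> e rB rD; have [fB /biduality_bij[biB bsB] /acyclicP aB /acyclicP aB'] := rB.
have [fD /biduality_bij[biD bsD] /acyclicP aD /acyclicP aD'] := rD.
have xD := totally_reflexive_extends rD; have e' := dual_exact e xD.
have [ii [ps pe]] := e; have [pi' [is' ie']] := e'.
(* Ext^1 of the dual of [A] is the cokernel of restricting functionals from the dual of [B] to that
   of [D]. It is zero: a functional on the dual of [D] is evaluation at some [p b], which extends to
   evaluation at [b]. *)
have xA' : extends C (Hom A C).
  apply/extendsP; have [d dE] := linear_of (@bid_linear D).
  have i0 : isExt C 0 (Hom A C) 'rV[R]_0.
    apply: (isExt0_extends (phi := \0) e'); first by apply/extendsP; exact: aB'.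
    split=> [v|P]; first by exists 0; apply/rowP; case.
    split=> // _; have [d' d'P] := bsD P; have [b bd] := ps d'.
    have [b' b'E] := linear_of (@bid_linear B); exists (b' b); apply: hom_ext => h.
    by rewrite hom_preE b'E bidE hom_preE bd d'P.
  by move=> V /(isExt_uniq i0) /trivial_iso; apply; exact: trivial_rV0.
split.
- exact: fin_gen_sub nR ii fB.
- apply/biduality_bij; split=> [a a0|P].
    apply: (linear_inj0 ii); apply: biB => h; exact: (a0 (hom_pre i h)).
  have [b bE] := bsB (hom_pre (hom_pre i (N := C)) P).
  have /pe[a ab] : p b = 0.
    apply: biD => h; have := bE (hom_pre p h); rewrite !hom_preE => <-.
    by rewrite (exact0 _ e') linear0.
  exists a => h; have [g <-] := is' h.
  by rewrite -hom_preE bE hom_preE ab.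
- exact/acyclicP/(acyclic_quot e aD).
- apply/acyclicP; exact: acyclic_coker e' aD' aB' xA'.
Qed.

(** Assuming Ext^1(D, C) = 0 keeps the dual sequence short exact, so both biduality conditions for
    [D] follow by a chase from those for [A] and [B]. *)
Lemma totally_reflexive_coker A B D (i : {linear A -> B}) (p : {linear B -> D}) :
  short_exact i p -> TR A -> TR B -> extends C D -> TR D.
Proof.
move=> e rA rB xD; have [fB /biduality_bij[biB bsB] /acyclicP aB /acyclicP aB'] := rB.
have [fA /biduality_bij[biA bsA] /acyclicP aA /acyclicP aA'] := rA.
have e' := dual_exact e xD; have [ii [ps pe]] := e; have [pi' [is' ie']] := e'.
split.
- exact: fin_gen_surj ps fB.
- apply/biduality_bij; split=> [d d0|P].
    (* If every map on [D] kills [p b], evaluation at [b] factors through the dual of [A], so it is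
       evaluation at some [i a]; reflexivity of [B] gives [b = i a]. *)
    have [b bd] := ps d; have [b' b'E] := linear_of (@bid_linear B).
    have [h|S SE] := factor (h := hom_fun (b' b)) (proj2 e').
      by rewrite b'E -[LHS]/(hom_fun h (p b)) bd.
    have [a aE] := bsA (hom_of S); rewrite -bd.
    suff -> : b = i a by rewrite (exact0 _ e).
    apply/eqP; rewrite -subr_eq0; apply/eqP/biB => h.
    have hb : hom_fun h b = hom_fun h (i a).
      by rewrite -bidE -b'E -SE; exact: (aE (hom_pre i h)).
    by rewrite linearB [X in X - _]hb subrr.
  have /extendsP/(_ _ _ _ _ e' (hom_fun P))[S SE] := aA' 0%N.
  have [b bE] := bsB (hom_of S); exists (p b) => h.
  by rewrite -SE -hom_preE -bE.
- exact/acyclicP/(acyclic_coker e aA aB xD).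
- exact/acyclicP/(acyclic_quot e' aA').
Qed.

End TotallyReflexive.

(** * Syzygies and bounds on the G_C-dimension *)

Section GCDim.
Variable R : comPzRingType.
Implicit Types A B D K L M N P Q U V W X : lmodType R.
Variable C : lmodType R.
Local Notation TR := (totally_reflexive C).

Hypotheses (nR : noetherian R) (sC : semidualizing C).

Lemma regular_hom : exists s : {linear C -> Hom R^o C}, forall c r, hom_fun (s c) r = r *: c.
Proof.
have /choice[s sE] : forall c, exists h : Hom R^o C, forall r, hom_fun h r = r *: c.
  move=> c; have [|h hE] := @linear_of R R^o C (fun r => r *: c).
    by move=> a x y; rewrite scalerDl scalerA.
  by exists (hom_of h) => r; exact: hE.
have [|t tE] := @linear_of R C (Hom R^o C) s; last by exists t => c r; rewrite tE.
move=> a x y; apply: hom_ext => r; rewrite -[RHS]/(a *: hom_fun (s x) r + hom_fun (s y) r) !sE.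
by rewrite scalerDr !scalerA mulrC.
Qed.

Lemma homothety_inj r : (forall c : C, r *: c = 0) -> r = 0.
Proof.
have [_ /bij_inj hi _] := sC => rc; apply: hi; apply: hom_ext => c.
by rewrite -[LHS]/(r *: c) rc -[RHS]/(0 *: c) scale0r.
Qed.

Lemma homothety_surj (h : {linear C -> C}) : exists r, forall c, h c = r *: c.
Proof.
have [_ [g _ gK] _] := sC; exists (g (hom_of h)) => c.
by rewrite -[LHS]/(hom_fun (hom_of h) c) -[in LHS](gK (hom_of h)).
Qed.

Lemma acyclic_semidualizing : acyclic C C.
Proof. by have [_ _ /acyclicP] := sC. Qed.

(** Under Hom(R, C) = C the biduality map of [R] becomes the homothety map, and the Ext condition on
    the dual becomes Ext^i(C, C) = 0. *)
Lemma totally_reflexive_regular : TR (R^o : lmodType R).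
Proof.
have [s sE] := regular_hom; split.
- by exists 1%N, (fun=> 1) => x; exists (fun=> x); rewrite big_ord1; exact/esym/mulr1.
- apply/biduality_bij; split=> [r r0|P].
    by apply: homothety_inj => c; rewrite -sE r0.
  have [r rE] := homothety_surj (hom_fun P \o s); exists r => h.
  have hE (x : R) : hom_fun h x = x *: hom_fun h 1.
    by rewrite -[in LHS](mulr1 x) -[x * 1]/(x *: (1 : R^o)) [LHS]linearZ.
  rewrite hE -rE /=; congr (hom_fun P _); apply: hom_ext => x.
  by rewrite sE hE.
- exact/acyclicP/acyclic_projective/projective_regular.
- apply/acyclicP; apply: acyclic_retract acyclic_semidualizing.
  exists (eval_at (X := R^o) (C := C) 1), s => h; apply: hom_ext => x.
  by rewrite sE -[in RHS](mulr1 x) -[x * 1]/(x *: (1 : R^o)) [RHS]linearZ.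
Qed.

Lemma totally_reflexive_power k : TR (power R^o k).
Proof.
elim: k => [|k IH]; first exact/totally_reflexive_trivial/trivial_rV0.
have [i [p e]] := short_exact_prod R^o (power R^o k).
exact: totally_reflexive_mid e totally_reflexive_regular IH.
Qed.

Lemma totally_reflexive_projective P : fin_gen P -> projective P -> TR P.
Proof.
move=> fP pP; have [k r] := fin_gen_projective_retract fP pP.
exact: totally_reflexive_retract r (totally_reflexive_power k).
Qed.

Lemma totally_reflexive_cover M : fin_gen M ->
  exists K P (k : {linear K -> P}) (s : {linear P -> M}),
  [/\ TR P, fin_gen K & short_exact k s].
Proof.
move=> /fin_gen_cover[k [p ps]]; have e := short_exact_ker ps.
exists (submodule (ker p)), (power R^o k), (\val : submodule (ker p) -> _), p; split=> //.
  exact: totally_reflexive_power.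
exact: (fin_gen_sub nR (proj1 e) (let: And4 f _ _ _ := totally_reflexive_power k in f)).
Qed.

(* G_C-dim M <= n *)
Fixpoint GC_le (n : nat) M : Prop :=
  if n is m.+1 then
    exists K X (k : {linear K -> X}) (s : {linear X -> M}),
      [/\ short_exact k s, TR X & GC_le m K]
  else TR M.

Lemma has_GC_resolutionP n M : has_GC_resolution C M n <-> GC_le n M.
Proof.
split.
  elim: n M => [|n IH] M [X [d [e [[es e0 ed] rX tX]]]].
    have ei : injective e.
      by apply: linear_inj => x /e0[y <-]; rewrite (tX 1%N _ y) // linear0.
    apply: totally_reflexive_iso (rX 0%N _) => //; exists e; exact: bij_linear.
  have ek := short_exact_ker es.
  pose v : {linear submodule (ker e) -> X 0%N} := \val.
  have [|u uE] := lift_ker (h := d 0%N) ek; first by move=> x; apply/e0; exists x.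
  exists (submodule (ker e)), (X 0%N), v, e; split=> //; first exact: rX.
  apply: IH; exists (fun i => X i.+1), (fun i => d i.+1), u.
  split=> [|i|i]; [|exact: (rX i.+1)|exact: (tX i.+1)].
  split=> [x|x|i x]; last exact: ed.
    have /e0[y yx] : e (v x) = 0 by apply/eqP; exact: (valP x).
    by exists y; apply: (proj1 ek); rewrite uE.
  rewrite -ed; split=> [ux|dx]; first by rewrite -uE ux linear0.
  by apply: (proj1 ek); rewrite uE dx linear0.
elim: n M => [|n IH] M.
  move=> rM; exists (fun i => if i is j.+1 then 'rV[R]_0 else M), (fun=> \0), idfun.
  split; [split=> [x|x|i x]|by case|by case=> // i _; exact: trivial_rV0].
  - by exists x.
  - by split=> /= [->|[y <-] //]; exists 0.
  - by split=> // _; exists 0; rewrite (@trivial_rV0 R x).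
move=> [K [X0 [k [s [[ki [ss se]] rX0 /IH[X [d [e [[es e0 ed] rX tX]]]]]]]]].
pose Y (i : nat) : lmodType R := if i is j.+1 then X j else X0.
pose dY i : {linear Y i.+1 -> Y i} :=
  match i return {linear Y i.+1 -> Y i} with
  | 0%N => (k \o e : {linear X 0%N -> X0})
  | j.+1 => d j
  end.
exists Y, dY, s.
split; [|by case=> // i; exact: (rX i)|by case=> // i; exact: (tX i)].
split=> // [x|[|i] x]; last exact: ed.
  rewrite se; split=> [[y <-]|[y <-]]; last by exists (e y).
  by have [z <-] := es y; exists z.
by rewrite -e0; split=> /= [/(linear_inj0 ki)|->]; rewrite ?linear0.
Qed.

Lemma GC_le_fin_gen n M : GC_le n M -> fin_gen M.
Proof.
case: n => [[]//|n [K [X [k [s [[_ [ss _]] [fX _ _ _] _]]]]]].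
exact: fin_gen_surj ss fX.
Qed.

(** The cover [X] of [B] restricts to a cover [W] of [A] with the same kernel, and [W] is totally
    reflexive as the kernel of [X -> D]. *)
Lemma GC_le_sub n A B D (i : {linear A -> B}) (p : {linear B -> D}) :
  short_exact i p -> TR D -> GC_le n B -> GC_le n A.
Proof.
move=> e rD; case: n => [rB|n [K [X [k [s [ek rX gK]]]]]].
  exact: totally_reflexive_ker e rB rD.
have [W [w [q [k' [s' [ew ek' _ _ _]]]]]] := short_exact_pull ek e.
exists K, W, k', s'; split=> //; exact: totally_reflexive_ker ew rX rD.
Qed.

(** Cover [B] by [X * P], where [X] covers [A] and [P] covers [B]. The kernel [L] is an extension of
    the totally reflexive module [W], the kernel of [P -> D], by the kernel [K] of [X -> A], so the
    induction applies to [L]. *)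
Lemma GC_le_ext n A B D (i : {linear A -> B}) (p : {linear B -> D}) :
  short_exact i p -> TR D -> GC_le n A -> GC_le n B.
Proof.
elim: n A B D i p => [|n IH] A B D i p e rD.
  by move=> rA; exact: totally_reflexive_mid e rA rD.
move=> gA; have fB : fin_gen B by apply: fin_gen_ext e (GC_le_fin_gen gA) _; case: rD.
move: gA => [K [X [k [s [ek rX gK]]]]].
have [L0 [P [l0 [u [rP _ eP]]]]] := totally_reflexive_cover fB.
have [W [w [q [j [v [ew ej qE wj iv]]]]]] := short_exact_pull eP e.
have rW : TR W := totally_reflexive_ker nR ew rP rD.
have [b bE] := copairing (i \o s) u.
have bs : surj b.
  by move=> y; have [x <-] := proj1 (proj2 eP) y; exists (0, x); rewrite bE linear0 add0r.
have eb := short_exact_ker bs; pose L := submodule (ker b).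
pose l : {linear L -> (X * P)%type} := \val.
exists L, (X * P)%type, l, b; split=> //.
  have [i1 [p1 e1]] := short_exact_prod X P; exact: totally_reflexive_mid e1 rX rP.
have [ii [ps pe]] := e; have [si [ss se]] := ek.
have lE z : i (s (l z).1) + u (l z).2 = 0.
  have : b (l z) = 0 := exact0 z eb; case: (l z) => x y; rewrite bE; exact.
have Ll x y : i (s x) + u y = 0 -> exists z, l z = (x, y).
  by move=> xy; apply/(proj2 (proj2 eb)); rewrite bE.
have [|r rE] := @lift_ker R _ _ _ L w q (snd \o l) ew.
  move=> z; rewrite qE -[u _]/(u (l z).2).
  have /eqP := lE z; rewrite addrC addr_eq0 => /eqP ->.
  by rewrite linearN (exact0 _ e) oppr0.
have [k' kE'] := pairing k (\0 : {linear K -> P}).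
have [|m mE] := @lift_inj R L (X * P)%type K l k' (proj1 eb).
  by move=> x; rewrite kE'; apply: Ll; rewrite (exact0 _ ek) !linear0 addr0.
apply: (IH K L W m r _ rW gK); split; first by move=> x y /(congr1 l); rewrite !mE !kE' => -[/si].
split=> [x|z].
  have [x' xx'] := ss (- v x); have [|z zE] := Ll x' (w x).
    by rewrite xx' linearN iv addNr.
  by exists z; apply: (proj1 ew); rewrite rE -[LHS]/(l z).2 zE.
split=> [rz|[y <-]]; last by apply: (proj1 ew); rewrite rE -[LHS]/(l (m y)).2 mE kE' linear0.
have l2 : (l z).2 = 0 by rewrite -[LHS](rE z) rz linear0.
have := lE z; rewrite l2 linear0 addr0 => /(linear_inj0 ii)/se[y yz].
by exists y; apply: (proj1 eb); rewrite -/l mE kE' yz [RHS]surjective_pairing l2.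
Qed.

(** The bound passes from the kernel [K'] of a given resolution up to the pullback [Q], an extension
    of [X] by [K'], and then down to [K], the kernel of [Q -> X']. *)
Lemma GC_le_syzygy n K X M (k : {linear K -> X}) (s : {linear X -> M}) :
  short_exact k s -> TR X -> GC_le n.+1 M -> GC_le n K.
Proof.
move=> e rX [K' [X' [k' [s' [e' rX' gK']]]]].
have [Q [q [q' [j [j' [eq' eq _ _]]]]]] := pullback e e'.
apply: GC_le_sub eq' rX' _; exact: GC_le_ext eq rX gK'.
Qed.

Lemma GC_le_Ext n i M : GC_le n M -> (n <= i)%N -> Ext0 C i M.
Proof.
elim: n i M => [|n IH] i M; first by move=> /totally_reflexive_acyclic.
move=> [K [X [k [s [e rX gK]]]]]; case: i => // i ni V.
move=> /(isExt_shift _ _ e (totally_reflexive_acyclic rX)); exact: IH.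
Qed.

End GCDim.

Section InfNat.

Lemma inf_natP (P : nat -> Prop) (n : nat) :
  inf_nat P = (n%:Z)%:E <-> P n /\ forall j, (j < n)%N -> ~ P j.
Proof.
rewrite /inf_nat; case: pselect => [h|nh]; last first.
  by split=> // -[Pn _]; case: nh; exists n; apply/asboolP.
case: ex_minnP => m /asboolP Pm mn; split=> [[<-]|[Pn nP]].
  by split=> // j jm /asboolP/mn; rewrite leqNgt jm.
do 2 congr (_ _); apply/eqP; rewrite eqn_leq mn ?andbT; last exact/asboolP.
by rewrite leqNgt; apply/negP => /nP; apply.
Qed.

Lemma inf_nat_int (P : nat -> Prop) (z : int) : inf_nat P = z%:E -> exists n : nat, z = n.
Proof.
by rewrite /inf_nat; case: pselect => // h [<-]; eexists.
Qed.

End InfNat.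

(** * Grade through Ext with values in C *)

Section HomNonzero.
Variable R : comPzRingType.
Implicit Types A B C D E K L M N P Q U V W X : lmodType R.

Lemma submodule_of V (P : V -> Prop) :
  P 0 -> (forall a x y, P x -> P y -> P (a *: x + y)) ->
  exists S : submodClosed V, forall x, x \in S <-> P x.
Proof.
move=> P0 PD; pose S : {pred V} := fun x => `[< P x >].
have cS : submod_closed S.
  split=> [|a x y]; rewrite !unfold_in /S; first exact/asboolP.
  by move=> /asboolP Px /asboolP Py; apply/asboolP/PD.
pose m := GRing.isSubmodClosed.Build R V S cS.
exists (HB.pack_for (submodClosed V) S m) => x.
by split=> [/asboolP|Px] //; apply/asboolP.
Qed.

(** An annihilator that is maximal among those of nonzero elements is prime. Without a maximal one,
    iterating [f] gives a strictly increasing chain of annihilators, against finite generation of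
    their union [J]. *)
Lemma associated_prime N : noetherian R -> ~ trivial_mod N ->
  exists2 x : N, x <> 0 & forall a b : R, (a * b) *: x = 0 -> a *: x = 0 \/ b *: x = 0.
Proof.
move=> nR ntN.
suff [x x0 mx] : exists2 x : N, x <> 0 & forall y : N, y <> 0 ->
    (forall r : R, r *: x = 0 -> r *: y = 0) -> forall r : R, r *: y = 0 -> r *: x = 0.
  exists x => // a b abx; have [|bx] := pselect (b *: x = 0); first by right.
  left; apply: (mx _ bx) => [r rx|].
    by rewrite scalerA mulrC -scalerA rx scaler0.
  by rewrite scalerA.
apply: contrapT => nx.
have /choice[f fP] : forall x : N, exists y : N, x <> 0 -> [/\ y <> 0,
    forall r : R, r *: x = 0 -> r *: y = 0 & exists r : R, r *: y = 0 /\ r *: x <> 0].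
  move=> x; have [->|x0] := pselect (x = 0); first by exists 0.
  apply: contrapT => ny; apply: nx; exists x => // y y0 xy r ry.
  by apply: contrapT => rx; apply: ny; exists y => _; split=> //; exists r.
have [x0 x00] : exists x : N, x <> 0.
  by apply: contrapT => nx0; apply: ntN => x; apply: contrapT => xn; apply: nx0; exists x.
pose s i := iter i f x0.
have sn i : s i <> 0 by elim: i => // i IH; have [] := fP _ IH.
have sS i (r : R) : r *: s i = 0 -> r *: s i.+1 = 0 by have [_ + _] := fP _ (sn i); exact.
have sm i j (r : R) : (i <= j)%N -> r *: s i = 0 -> r *: s j = 0.
  by move=> /subnK <-; elim: (j - i)%N => // k IH /IH/sS.
have [||J JP] := @submodule_of R^o (fun r => exists i, (r : R) *: s i = 0).
- by exists 0%N; rewrite scale0r.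
- move=> a x y [i xi] [j yj]; exists (maxn i j).
  by rewrite scalerDl -scalerA (sm i) ?leq_maxl // (sm j) ?leq_maxr // scaler0 addr0.
have [k [g gE]] := nR J.
have /choice[e eP] : forall i : 'I_k, exists n, (\val (g i) : R) *: s n = 0.
  by move=> i; apply/JP; exact: (valP (g i)).
(* From stage [n] on, all generators of [J] annihilate [s n], so no [r] in [J] can be new at stage
   [n.+1]. *)
pose n := (\max_i e i)%N; have [_ _ [r [r1 rn]]] := fP _ (sn n); apply: rn.
have rJ : (r : R^o) \in J by apply/JP; exists n.+1.
pose v : {linear submodule J -> R^o} := \val.
have [c /(congr1 v) rE] := gE (Sub (r : R^o) rJ).
rewrite -[r]/(v (Sub (r : R^o) rJ)) rE linear_sum scaler_suml big1 // => i _.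
rewrite -[v _]/(c i * (\val (g i) : R)) -scalerA (sm (e i)) ?scaler0 //.
exact: (leq_bigmax i).
Qed.

(* Induct on the number of generators of C. Either the annihilator of C / R c still kills x, or
   some s with s x <> 0 maps C into R c, and C -> R c -> R x is a nonzero map. *)
Lemma hom_prime N (x : N) : x <> 0 ->
  (forall a b : R, (a * b) *: x = 0 -> a *: x = 0 \/ b *: x = 0) ->
  forall k C (g : 'I_k -> C), (forall c, exists r : 'I_k -> R, c = \sum_i r i *: g i) ->
  (forall r : R, (forall c : C, r *: c = 0) -> r *: x = 0) ->
  exists (h : {linear C -> N}) (c : C), h c <> 0.
Proof.
move=> x0 px; elim=> [|k IH] C g gE ann.
  case: x0; rewrite -(scale1r x); apply: ann => c.
  by have [r ->] := gE c; rewrite big_ord0 scaler0.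
pose c0 := g ord0.
have [m mE] : exists m : {linear R^o -> C}, forall r, m r = r *: c0.
  by apply: linear_of => a r r'; rewrite scalerDl scalerA.
have me := coker_exact m; set q := quotmod_pi (im m) in me.
have [annq|/existsNP[s /not_implyP[sC sx]]] :=
    pselect (forall r : R, (forall c : coker m, r *: c = 0) -> r *: x = 0).
  have [] := IH (coker m) (fun i => q (g (lift ord0 i))) _ annq.
    move=> d; have [c <-] := proj1 me d; have [r rE] := gE c.
    exists (fun i => r (lift ord0 i)); rewrite {1}rE big_ord_recl linearD.
    rewrite -mE (right_exact0 _ me) add0r linear_sum; apply: eq_bigr => i _.
    exact: linearZ.
  move=> h [d hd]; have [c cd] := proj1 me d; exists (h \o q), c.
  by rewrite /= cd.
have sc c : exists r : R, r *: c0 = s *: c.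
  have [r rE] : exists r, m r = s *: c.
    by apply/(proj2 me); rewrite linearZ; exact: sC.
  by exists r; rewrite -mE.
(* This makes [r c0 -> r x] well defined: [u s] kills [C] because [s C] lies in [R c0], and
   primality with [s x <> 0] leaves [u x = 0]. *)
have c0x (u : R) : u *: c0 = 0 -> u *: x = 0.
  move=> uc0; suff /px[] // : (u * s) *: x = 0 by [].
  apply: ann => c; have [r rE] := sc c.
  by rewrite -scalerA -rE scalerA mulrC -scalerA uc0 scaler0.
have [] := @linear_of_rel R C N (fun c y => exists r : R, r *: c0 = s *: c /\ y = r *: x).
- move=> a c c' y y' [r [rE ->]] [r' [rE' ->]]; exists (a * r + r').
  by rewrite !scalerDl -!scalerA rE rE' scalerDr [a *: (s *: _)]scalerA mulrC -scalerA.
- by move=> c; have [r rE] := sc c; exists (r *: x), r.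
- by move=> y [r [+ ->]]; rewrite scaler0 => /c0x.
move=> h hE; exists h, c0; suff -> : h c0 = s *: x by [].
by apply/hE; exists s.
Qed.

Lemma hom_nonzero C N : noetherian R -> fin_gen C ->
  (forall r : R, (forall c : C, r *: c = 0) -> r = 0) -> ~ trivial_mod N ->
  exists (h : {linear C -> N}) (c : C), h c <> 0.
Proof.
move=> nR [k [g gE]] annC /(associated_prime nR)[x x0 px].
apply: (hom_prime x0 px gE) => r /annC ->; exact: scale0r.
Qed.

End HomNonzero.

(** * Comparing Ext into R with Ext into C *)

Section Grade.
Variable R : comPzRingType.
Implicit Types A B D E K L M N P Q U V W X : lmodType R.
Variable C : lmodType R.

Lemma trivial_Ext_surj M N j :
  trivial_mod (Ext M N j.+1) <-> surj (hom_pre (syz_incl M j) (N := N)).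
Proof.
have [phi [ps pe]] := Ext_right_exact N M j; split=> [t h|s v].
  by have [g gh] := (pe h).1 (t _); exists g.
by have [h <-] := ps v; apply/pe/s.
Qed.

(* Ext^j(C, U) = 0 for j > 0 *)
Definition coacyclic U := forall j, surj (hom_pre (syz_incl C j) (N := U)).

(** The obstruction to lifting [g] is the class of [m] in Ext^1(K, U). Extending [m] to [m'] on [P]
    corrects [h] by a map into [U] so that it descends to [K]. *)
Lemma lift_quot K L P U V W (k : {linear L -> P}) (s : {linear P -> K})
    (i : {linear U -> V}) (p : {linear V -> W}) :
  projective P -> short_exact k s -> short_exact i p -> surj (hom_pre k (N := U)) ->
  forall g : {linear K -> W}, exists h : {linear K -> V}, forall x, p (h x) = g x.
Proof.
move=> pP e e' kU g; have [h hE] := pP V W p (g \o s) (proj1 (proj2 e')).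
have [|m mE] := @lift_ker R _ _ _ _ i p (h \o k) e'.
  by move=> x /=; rewrite hE /= (exact0 _ e) linear0.
have [m' mE'] := surj_hom m kU.
have [|f fE] := factor (h := h \- (i \o m')) (proj2 e).
  by move=> x /=; rewrite mE' mE subrr.
exists f => y; have [x <-] := proj1 (proj2 e) y.
by rewrite fE /= linearB (exact0 _ e') subr0 hE.
Qed.

Lemma coacyclic_lift U V W (i : {linear U -> V}) (p : {linear V -> W}) :
  short_exact i p -> coacyclic U -> 
  forall g : {linear C -> W}, exists h : {linear C -> V}, forall x, p (h x) = g x.
Proof.
move=> e aU; apply: lift_quot (syz_exact C 0) e (aU 0%N); exact: free_projective.
Qed.

(** A map from a syzygy of [C] to [W] lifts to [V], the obstruction being an Ext of [C] into [U] one
    degree higher; the lift then extends because [V] is coacyclic. *)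
Lemma coacyclic_quot U V W (i : {linear U -> V}) (p : {linear V -> W}) :
  short_exact i p -> coacyclic U -> coacyclic V -> coacyclic W.
Proof.
move=> e aU aV j; apply: hom_surj => g.
have [|h hE] := lift_quot _ (syz_exact C j.+1) e (aU j.+1) g; first exact: free_projective.
have [f fE] := surj_hom h (aV j).
by exists (p \o f) => x; rewrite /= fE hE.
Qed.

Lemma free_hom_ext T A (f g : {linear free R T -> A}) :
  (forall t, f (free_basis R t) = g (free_basis R t)) -> f =1 g.
Proof.
move=> fg x; have [r ur xr] := free_supp x.
rewrite -(free_expand x) /= (free_extE (@free_basis R T) ur xr) !linear_sum.
by apply: eq_bigr => t _; rewrite !linearZ fg.
Qed.

(** Hom(R^(T), U) is a product of copies of [U], so maps into it are extended one basis element at a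
    time. *)
Lemma coacyclic_free T U : coacyclic U -> coacyclic (Hom (free R T) U).
Proof.
move=> aU j; apply: hom_surj => g; set k := syz_incl C j.
have /choice[h hE] : forall t, exists h : {linear std_mod C j -> U},
    forall x, h (k x) = hom_fun (g x) (free_basis R t).
  move=> t; have [h hE] := surj_hom (@eval_at R (free R T) U (free_basis R t) \o g) (aU j).
  by exists h => x; rewrite hE.
pose f y := hom_of (free_ext (fun t => h t y) : {linear free R T -> U}).
have fE y t : hom_fun (f y) (free_basis R t) = h t y by exact: (free_ext_basis (fun t => h t y)).
have [|f' f'E] := @linear_of R _ _ f.
  move=> a x y; apply: hom_ext; apply: free_hom_ext => t.
  apply: (etrans (fE _ _)); rewrite linearP.
  rewrite -[RHS]/(a *: hom_fun (f x) (free_basis R t) + hom_fun (f y) (free_basis R t)).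
  by rewrite !fE.
exists f' => x; rewrite f'E; apply: hom_ext; apply: free_hom_ext => t.
by apply: (etrans (fE _ _)); exact: hE.
Qed.

Hypotheses (nR : noetherian R) (sC : semidualizing C).

(** This is Hom(C, Hom(Z, C)) = Hom(Z, Hom(C, C)) = Hom(Z, R), using the homothety isomorphism;
    [hom_swapV] is the inverse. *)
Lemma hom_swap (Z : lmodType R) (g : {linear C -> Hom Z C}) :
  exists r : {linear Z -> R^o}, forall c z, hom_fun (g c) z = (r z : R) *: c.
Proof.
have /choice[r rE] : forall z, exists r : R, forall c, hom_fun (g c) z = r *: c.
  by move=> z; exact: (homothety_surj sC (eval_at z \o g)).
have [|r' rE'] := @linear_of R Z R^o r; last by exists r' => c z; rewrite rE' rE.
move=> a x y; apply/eqP; rewrite -subr_eq0; apply/eqP/(homothety_inj sC) => c.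
rewrite scalerBl; apply/eqP; rewrite subr_eq0 -rE linearP; apply/eqP.
rewrite -[X in _ = X *: c]/(a * r x + r y) scalerDl -scalerA.
by congr (a *: _ + _); exact: rE.
Qed.

Lemma hom_swapV (Z : lmodType R) (r : {linear Z -> R^o}) :
  exists g : {linear C -> Hom Z C}, forall c z, hom_fun (g c) z = (r z : R) *: c.
Proof.
have [s sE] := regular_hom C; exists (hom_pre r (N := C) \o s) => c z.
by rewrite /= hom_preE sE.
Qed.

(** The dual of the zeroth syzygy is Hom(E, C) = 0. Each vanishing Ext makes the dual of the next
    syzygy a quotient of the dual of a free module by the previous dual, and duals of free modules
    are coacyclic since Ext^j(C, C) = 0. *)
Lemma coacyclic_dual_syz E i : (forall j, (j <= i)%N -> trivial_mod (Ext E C j)) ->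
  coacyclic (Hom (syzygy E i) C).
Proof.
elim: i => [|i IH] tE.
  have /trivial_Ext_res0 t0 := tE 0%N isT.
  move=> j h; exists 0; apply: hom_ext => x.
  by rewrite [LHS]t0 [RHS]t0.
have [pi pe] := dual_left_exact C (proj2 (syz_exact E i)).
have /trivial_Ext_surj s := tE i.+1 (leqnn _).
apply: (coacyclic_quot (i := hom_pre (free_cover (syzygy E i)) (N := C))
  (p := hom_pre (syz_incl E i) (N := C))); first by split.
  by apply: IH => j ji; apply: tE; exact: leqW.
apply: coacyclic_free => j; apply/trivial_Ext_surj; by have [_ _] := sC; apply.
Qed.

Lemma trivial_Ext_ring E i : (forall j, (j < i)%N -> trivial_mod (Ext E C j)) ->
  trivial_mod (Ext E R^o i) <-> trivial_mod (Ext E C i).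
Proof.
have [fC _ _] := sC; have hn := hom_nonzero nR fC (homothety_inj sC).
case: i => [_|i tE].
  rewrite !trivial_Ext_res0; split=> t; last first.
    move=> r; have [g gE] := hom_swapV (hom_fun r); apply: hom_ext => z.
    apply: (homothety_inj sC) => c; rewrite -gE; exact: (congr1 (fun f => hom_fun f z) (t _)).
  apply: contrapT => /hn[g [c gc]]; apply: gc; have [r rE] := hom_swap g.
  apply: hom_ext => z; rewrite rE.
  have -> : r z = 0 := congr1 (fun f => hom_fun f z) (t (hom_of r)).
  exact: scale0r.
have aJ := coacyclic_dual_syz tE.
pose cov : {linear Hom (syzygy E i) C -> _} := hom_pre (free_cover (syzygy E i)) (N := C).
pose res : {linear _ -> Hom (syzygy E i.+1) C} := hom_pre (syz_incl E i) (N := C).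
have [pi pe] : injective cov /\ forall h, res h = 0 <-> exists g, cov g = h.
  exact: dual_left_exact (proj2 (syz_exact E i)).
split=> [/trivial_Ext_surj sR|/trivial_Ext_surj sC'].
  (* The image [I] of [res] is coacyclic, so a map from [C] to the Ext lifts to the dual of the
     syzygy. Swapped into a map to [R], it extends over the free module by [sR], so its class is
     zero; by [hn] the Ext itself then vanishes. *)
  have [I [j [g [ji gs jg]]]] := im_exact res.
  have eI : short_exact cov g.
    split=> //; split=> // x; rewrite -pe -jg; split=> [->|/(linear_inj0 ji)//].
    exact: linear0.
  have aI : coacyclic I.
    apply: coacyclic_quot eI aJ _.
    apply: coacyclic_free => k; apply/trivial_Ext_surj; by have [_ _] := sC; apply.
  have [phi [ps ph]] := Ext_right_exact C E i.
  have eE : short_exact j phi.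
    split=> //; split=> // x; rewrite ph; split=> -[y <-].
      by exists (g y); rewrite jg.
    by have [z <-] := gs y; exists z; rewrite jg.
  apply: contrapT => /hn[h [c hc]]; apply: hc.
  have [h' h'E] := coacyclic_lift eE aI h.
  have [r rE] := hom_swap h'; have [r' rE'] := surj_hom r sR.
  have [g' gE'] := hom_swapV r'.
  rewrite -h'E; apply/ph; exists (g' c); apply: hom_ext => z.
  by rewrite hom_preE gE' rE' rE.
(* Conversely [res] is surjective, so the swap [g] of [r] lifts along it; swapping the lift back
   extends [r]. *)
apply/trivial_Ext_surj/hom_surj => r; have [g gE] := hom_swapV r.
have e : short_exact cov res by split.
have [h hE] := coacyclic_lift e aJ g.
have [r' rE'] := hom_swap h; exists r' => z.
apply/eqP; rewrite -subr_eq0; apply/eqP/(homothety_inj sC) => c.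
by rewrite scalerBl -rE' -gE -hE hom_preE subrr.
Qed.

Lemma grade_semidualizing E n :
  grade E = (n%:Z)%:E <->
  ~ trivial_mod (Ext E C n) /\ forall j, (j < n)%N -> trivial_mod (Ext E C j).
Proof.
have vanish k : (forall j, (j < k)%N -> trivial_mod (Ext E R^o j)) <->
                (forall j, (j < k)%N -> trivial_mod (Ext E C j)).
  elim: k => [|k IH]; first by split.
  split=> t j; rewrite ltnS leq_eqVlt => /orP[/eqP->|].
  - have tk := fun j (jk : (j < k)%N) => t j (leqW jk).
    exact/(trivial_Ext_ring (IH.1 tk))/t.
  - by apply: (IH.1 _) => i ik; apply: t; exact: leqW.
  - have tk := fun j (jk : (j < k)%N) => t j (leqW jk).
    exact/(trivial_Ext_ring tk)/t.
  - by apply: (IH.2 _) => i ik; apply: t; exact: leqW.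
rewrite /grade inf_natP; split=> [[nt t]|[nt t]].
  have t' : forall j, (j < n)%N -> trivial_mod (Ext E C j).
    by apply/vanish => j /t /contrapT.
  by split=> // /(trivial_Ext_ring t').
split; first by move=> /(trivial_Ext_ring t).
by move=> j jn; apply; move: j jn; apply/vanish.
Qed.

End Grade.

(** * The transpose *)

Section Transpose.
Variable R : comPzRingType.
Implicit Types A B D E K L M N P Q T U V W X Y : lmodType R.
Variable C : lmodType R.
Local Notation TR := (totally_reflexive C).
Local Notation dual f := (hom_pre f (N := C)).
Local Notation GC_le := (GC_le C).
Local Notation isExt := (isExt C).
Local Notation Ext0 := (Ext0 C).

Hypotheses (nR : noetherian R) (sC : semidualizing C).
Let fC : fin_gen C := let: And3 f _ _ := sC in f.

Lemma isExt0_right_exact K X M V (k : {linear K -> X}) (s : {linear X -> M}) :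
  short_exact k s -> extends C X -> isExt 0 M V ->
  exists phi : {linear Hom K C -> V}, right_exact (dual k) phi.
Proof.
move=> e xX iV; have r := coker_exact (dual k); have [qs qe] := r.
have [f fb] := isExt_uniq (isExt0_extends e xX r) iV; have [g fK gK] := fb.
exists (f \o quotmod_pi (im (dual k))); split=> [v|h].
  by have [h hE] := qs (g v); exists h; rewrite /= hE gK.
rewrite -qe; split=> /= [/(linear_inj0 (bij_inj fb))//|->]; exact: linear0.
Qed.

Lemma bid_iso X : TR X -> exists b : {linear X -> Hom (Hom X C) C},
  bijective b /\ forall x h, hom_fun (b x) h = hom_fun h x.
Proof.
move=> [_ bX _ _]; have [b bE] := linear_of (@bid_linear R C X).
exists b; split=> [|x h]; first by rewrite (funext bE).
by rewrite bE.
Qed.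

Lemma dual_separates X x : TR X -> (forall h : Hom X C, hom_fun h x = 0) -> x = 0.
Proof. by case=> _ /biduality_bij[+ _] _ _; exact. Qed.

Lemma dual_dual_ev X (h : {linear Hom X C -> C}) : TR X ->
  exists x, forall u, h u = hom_fun u x.
Proof. by case=> _ /biduality_bij[_ /(_ (hom_of h))]. Qed.

Lemma image_exact X1 X0 M (f : {linear X1 -> X0}) (p : {linear X0 -> M}) :
  right_exact f p -> exists N (j : {linear N -> X0}) (g : {linear X1 -> N}),
    [/\ short_exact j p, surj g & forall x, j (g x) = f x].
Proof.
move=> [ps pe]; have [N [j [g [ji gs jg]]]] := im_exact f.
exists N, j, g; split=> //; split=> //; split=> // x; rewrite pe.
split=> -[y <-]; first by exists (g y).
by have [z <-] := gs y; exists z.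
Qed.

(** The image [I] of the dual map and its kernel [J] are totally reflexive, so dualizing stays exact
    and presents the dual of [J] by the bidual of [f]. Biduality identifies this with the
    presentation of [M]. *)
Lemma totally_reflexive_transpose X1 X0 M T (f : {linear X1 -> X0}) (p : {linear X0 -> M})
    (q : {linear Hom X1 C -> T}) :
  TR X1 -> TR X0 -> right_exact f p -> right_exact (dual f) q -> TR T -> TR M.
Proof.
move=> r1 r0 ef eq rT; have r1' := totally_reflexive_dual nR fC r1.
have r0' := totally_reflexive_dual nR fC r0.
have [I [j [g [ej gs jg]]]] := image_exact eq.
have rI := totally_reflexive_ker nR ej r1' rT.
have [J [v eg]] := kernel_exact gs.
have rJ : TR J := totally_reflexive_ker nR eg r0' rI.
have [_ [js _]] := dual_exact ej (totally_reflexive_extends rT).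
have [_ [vs ve]] := dual_exact eg (totally_reflexive_extends rI).
have er : right_exact (dual (dual f)) (dual v).
  split=> // x; rewrite ve; split=> -[y <-].
    have [z <-] := js y; exists z; apply: hom_ext => u; rewrite !hom_preE.
    by rewrite jg.
  by exists (dual j y); apply: hom_ext => u; rewrite !hom_preE jg.
have [b1 [bb1 b1E]] := bid_iso r1; have [b0 [bb0 b0E]] := bid_iso r0.
have i : iso M (Hom J C).
  apply: (coker_iso bb1 bb0 _ ef er) => x; apply: hom_ext => h.
  by rewrite b0E hom_preE b1E.
apply: totally_reflexive_iso (iso_sym i) _; exact: totally_reflexive_dual.
Qed.

(** The image [N] of [f] is totally reflexive, hence so is the kernel [Z] of [X1 -> N]. The dual of
    [X1] maps onto that of [Z] with kernel the dual of [N]; modulo the dual of [X0] this becomes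
    [V -> T -> Y] with [Y] the dual of [Z]. *)
Lemma transpose_base X1 X0 M T V (f : {linear X1 -> X0}) (p : {linear X0 -> M})
    (q : {linear Hom X1 C -> T}) :
  TR X1 -> TR X0 -> right_exact f p -> right_exact (dual f) q ->
  GC_le 1 M -> isExt 0 M V ->
  trivial_mod (Hom V C) /\
  exists Y (i : {linear V -> T}) (s : {linear T -> Y}), short_exact i s /\ TR Y.
Proof.
move=> r1 r0 ef eq gM iV; have [N [j [g [ej gs jg]]]] := image_exact ef.
have rN : TR N := GC_le_syzygy nR sC ej r0 gM.
have [Z [z ez]] := kernel_exact gs.
have rZ : TR Z := totally_reflexive_ker nR ez r1 rN.
have [gi' [zs ze]] := dual_exact ez (totally_reflexive_extends rN).
have [phi ephi] := isExt0_right_exact ej (totally_reflexive_extends r0) iV.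
have [phis phie] := ephi; have [qs qe] := eq.
have fE u : dual f u = dual g (dual j u) by apply: hom_ext => x; rewrite !hom_preE jg.
split=> [h|].
  (* A functional on [V], pulled back to the dual of [N], is evaluation at some [n]. It kills the
     restrictions from [X0], so all maps on [X0] vanish at [j n], which is therefore 0. *)
  have [n nE] := dual_dual_ev (hom_fun h \o phi) rN.
  suff n0 : n = 0.
    apply: hom_ext => v; have [u <-] := phis v.
    by rewrite -[LHS]/((hom_fun h \o phi) u) nE n0 linear0.
  apply: (linear_inj0 (proj1 ej)); apply: (dual_separates r0) => w.
  have := nE (dual j w); rewrite hom_preE => <- /=.
  by rewrite (right_exact0 _ ephi) linear0.
have [u|i iE] := factor (h := q \o dual g) ephi.
  by rewrite /= -fE; exact: right_exact0.
have [u|s sE] := factor (h := dual z) eq.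
  by rewrite /= fE; apply: hom_ext => x; rewrite !hom_preE (exact0 x ez) !linear0.
exists (Hom Z C), i, s; split; last exact: totally_reflexive_dual.
split.
  apply: linear_inj => v; have [h <-] := phis v; rewrite iE => /qe[u].
  by rewrite /= fE => /gi' uh; apply/phie; exists u.
split=> [y|y]; first by have [u <-] := zs y; exists (q u); rewrite sE.
have [u <-] := qs y; rewrite sE ze; split=> [[h <-]|[v]].
  by exists (phi h); rewrite iE.
have [h <-] := phis v; rewrite iE => /(congr1 s); rewrite /= !sE => e.
by apply/ze; rewrite -e; apply/ze; exists h.
Qed.

(** Since Ext^1(M, C) = 0, maps on [N] extend to [X0], so the images of the duals of [X0] and [N] in
    the dual of [X1] coincide. The latter is the kernel of the dual of [f2], whence the embedding of
    [T]. *)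
Lemma transpose_step X1 X0 M N T (f : {linear X1 -> X0}) (p : {linear X0 -> M})
    (q : {linear Hom X1 C -> T}) (j : {linear N -> X0}) (g : {linear X1 -> N}) :
  TR X1 -> TR X0 -> right_exact (dual f) q ->
  short_exact j p -> surj g -> (forall x, j (g x) = f x) -> extends C M ->
  exists X2 T' (f2 : {linear X2 -> X1}) (q' : {linear Hom X2 C -> T'})
    (i : {linear T -> Hom X2 C}),
  [/\ TR X2, right_exact f2 g, right_exact (dual f2) q', short_exact i q' & Ext0 0 T'].
Proof.
move=> r1 r0 eq ej gs jg xM; have [Z [z ez]] := kernel_exact gs.
have fZ : fin_gen Z by apply: fin_gen_sub nR (proj1 ez) _; case: r1.
have [K [X2 [k [s [r2 _ es]]]]] := totally_reflexive_cover nR sC fZ.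
pose f2 : {linear X2 -> X1} := z \o s.
have ef2 : right_exact f2 g.
  split=> // x; rewrite (proj2 (proj2 ez)); split=> -[y <-]; last by exists (s y).
  by have [w <-] := proj1 (proj2 es) y; exists w.
have eq' := coker_exact (dual f2); set q' := quotmod_pi _ in eq'.
have [gi ge] := dual_left_exact C ef2.
have [_ [js je]] := dual_exact ej xM; have [qs qe] := eq.
have fE u : dual f u = dual g (dual j u) by apply: hom_ext => x; rewrite !hom_preE jg.
have [u|i iE] := factor (h := dual f2) eq.
  by rewrite /= fE; apply/ge; eexists.
have ei : short_exact i q'.
  split.
    apply: linear_inj => y; have [u <-] := qs y; rewrite iE => /ge[h <-].
    by have [w <-] := js h; apply/qe; exists w; exact: fE.
  split; first exact: proj1 eq'.
  move=> x; rewrite (proj2 eq'); split=> -[y <-]; first by exists (q y); rewrite iE.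
  by have [u <-] := qs y; exists u; rewrite iE.
exists X2, (coker (dual f2)), f2, q', i; split=> // U iU.
have r2' := totally_reflexive_dual nR fC r2.
have [psi [psis psie]] := isExt0_right_exact ei (totally_reflexive_extends r2') iU.
move=> w; have [h <-] := psis w; apply/psie.
(* A functional on [T] is evaluation at an [x] of [X1] with [f x = 0]. Then [x = f2 y], and
   evaluation at [y] extends it. *)
have [x xE] := dual_dual_ev (hom_fun h \o q) r1.
have fx : f x = 0.
  apply: (dual_separates r0) => u; have := xE (dual f u); rewrite hom_preE => <- /=.
  by rewrite (right_exact0 _ eq) linear0.
have /(proj2 ef2)[y yx] : g x = 0 by apply: (linear_inj0 (proj1 ej)); rewrite jg.
have [b [_ bE]] := bid_iso r2; exists (b y); apply: hom_ext => v.
have [u <-] := qs v; rewrite hom_preE iE bE -[RHS]/((hom_fun h \o q) u) xE -yx //.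
Qed.

(* With T the C-transpose of M, Ext^(k+1)(M, C) = V is tied to T by
   0 -> V -> T -> Y -> 0 if k = 0, and by 0 -> T -> X2^C -> T' -> 0 with T' the transpose of
   the first syzygy of M if k > 0. *)
Lemma transpose_Ext k X1 X0 M T V (f : {linear X1 -> X0}) (p : {linear X0 -> M})
    (q : {linear Hom X1 C -> T}) :
  TR X1 -> TR X0 -> right_exact f p -> right_exact (dual f) q ->
  GC_le k.+1 M -> (forall i, (i < k)%N -> Ext0 i M) -> isExt k M V ->
  [/\ forall i U, isExt i T U <-> isExt (k + i) V U,
      forall l, GC_le l.+1 T -> GC_le (k + l).+1 V,
      forall m, GC_le m V -> ~ TR M -> exists2 t, m = (k + t).+1 & GC_le t.+1 T &
      trivial_mod (Hom V C) /\ forall i, (i < k)%N -> Ext0 i V].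
Proof.
elim: k X1 X0 M T f p q => [|k IH] X1 X0 M T f p q r1 r0 ef eq gM xM iV.
  have [dV [Y [i [s [e rY]]]]] := transpose_base r1 r0 ef eq gM iV.
  split=> // [n U|l|m gV nM].
  - by rewrite (isExt_acyclic_quot n U e (totally_reflexive_acyclic rY)).
  - exact: GC_le_sub e rY.
  - have := GC_le_ext nR sC e rY gV; case: m {gV} => [rT|t gT]; last by exists t.
    by case: nM; exact: totally_reflexive_transpose ef eq rT.
have [N [j [g [ej gs jg]]]] := image_exact ef.
have xM0 : extends C M by apply/extendsP; exact: xM.
have [X2 [T' [f2 [q' [i [r2 ef2 eq' ei x0]]]]]] := transpose_step r1 r0 eq ej gs jg xM0.
have aX := totally_reflexive_acyclic r0.
have gN : GC_le k.+1 N := GC_le_syzygy nR sC ej r0 gM.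
have r2' := totally_reflexive_dual nR fC r2.
have [||E1 E2 E3 [E4 E5]] := IH _ _ _ _ _ _ _ r2 r1 ef2 eq' gN.
- by move=> n nk U /(isExt_shift _ _ ej aX); exact: xM.
- exact/(isExt_shift _ _ ej aX).
have sh n U := isExt_shift n U ei (totally_reflexive_acyclic r2').
split=> [n U|l gT|m gV nM|].
- by rewrite sh E1 addSnnS.
- by rewrite addSnnS; apply: E2; exists T, (Hom X2 C), i, q'.
(* If [N] were totally reflexive, so would be [M], as Ext^1(M, C) = 0. For [t = 0] the syzygy [T] of
   [T'] would be totally reflexive, and again so would [M]. *)
- have [|t mE gT'] := E3 m gV.
    by move=> rN; apply: nM; exact: totally_reflexive_coker ej rN r0 xM0.
  have := GC_le_syzygy nR sC ei r2' gT'; case: t {gT'} mE => [|t] mE gT.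
    by case: nM; exact: totally_reflexive_transpose ef eq gT.
  by exists t; rewrite // mE addSnnS.
(* The new top index [k] is Ext^1(T', C), which vanishes by [transpose_step]. *)
- split=> // n; rewrite ltnS leq_eqVlt => /orP[/eqP->|/E5 //].
  by move=> U iU; apply: x0; apply/E1; rewrite addn0.
Qed.

Lemma totally_reflexive_presentation M : fin_gen M ->
  exists X1 X0 (f : {linear X1 -> X0}) (p : {linear X0 -> M}),
    [/\ TR X1, TR X0 & right_exact f p].
Proof.
move=> fM; have [K [X0 [k [p [r0 fK ek]]]]] := totally_reflexive_cover nR sC fM.
have [L [X1 [l [s [r1 _ es]]]]] := totally_reflexive_cover nR sC fK.
exists X1, X0, (k \o s), p; split=> //; split; first exact: proj1 (proj2 ek).
move=> x; rewrite (proj2 (proj2 ek)); split=> -[y <-]; last by exists (s y).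
by have [w <-] := proj1 (proj2 es) y; exists w.
Qed.

(** * Perfection of the dual Ext and of the transpose *)

Lemma GC_dimP M n : GC_dim C M = (n%:Z)%:E <-> GC_le n M /\ forall j, (j < n)%N -> ~ GC_le j M.
Proof.
rewrite /GC_dim inf_natP; split=> -[]/has_GC_resolutionP g l; split=> // j /l nj.
all: by move=> /has_GC_resolutionP.
Qed.

Lemma GC_dim_Ext M n : GC_le n.+1 M -> ~ trivial_mod (Ext M C n.+1) ->
  GC_dim C M = (n.+1%:Z)%:E.
Proof.
move=> gM nt; apply/GC_dimP; split=> // j; rewrite ltnS => jn gj.
by apply: nt; apply/Ext0P; exact: GC_le_Ext gj jn.
Qed.

(** As Hom(E, C) = 0, the dual of [f] is injective and resolves the transpose in length one, which
    bounds the dimension of [V]. The top Ext of [V] is Ext^1 of the transpose, the cokernel of the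
    bidual of [f], that is [E]; it is nonzero. *)
Lemma GC_perfect_dual m E V : GC_le m.+1 E ->
  (forall i, (i < m.+1)%N -> trivial_mod (Ext E C i)) -> ~ trivial_mod (Ext E C m.+1) ->
  isExt m E V -> GC_perfect C V /\ GC_dim C V = (m.+1%:Z)%:E.
Proof.
move=> gE tE ntE iV.
have [X1 [X0 [f [p [r1 r0 ef]]]]] := totally_reflexive_presentation (GC_le_fin_gen gE).
have eq := coker_exact (dual f); set q := quotmod_pi _ in eq.
have [|E1 E2 _ [E4 E5]] := transpose_Ext r1 r0 ef eq gE _ iV.
  by move=> i im; apply/Ext0P/tE.
have r1' := totally_reflexive_dual nR fC r1; have r0' := totally_reflexive_dual nR fC r0.
have /trivial_Ext_res0 dE := tE 0%N isT.
have [pi pe] := dual_left_exact C ef.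
have efq : short_exact (dual f) q.
  split=> //; apply: linear_inj => u /pe[h <-].
  by rewrite (dE h) linear0.
have gV : GC_le m.+1 V.
  by rewrite -[m]addn0; apply: E2; exists (Hom X0 C), (Hom X1 C), (dual f), q.
have ntV : ~ trivial_mod (Ext V C m.+1).
  move=> tU; apply: ntE; apply/Ext0P.
  suff tE0 : trivial_mod E by exact: (acyclic_projective (projective_trivial tE0)).
  move=> y; have [x <-] := proj1 ef y.
  have /E1 : isExt (m + 0) V (Ext V C m.+1) by rewrite addn0; exact: isExt_Ext.
  move=> /(isExt0_right_exact efq (totally_reflexive_extends r1'))[phi [_ phie]].
  have [b1 [[b1' _ b1K] b1E]] := bid_iso r1; have [b0 [bb0 b0E]] := bid_iso r0.
  have [P PE] := (phie (b0 x)).1 (tU _).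
  apply/(proj2 ef); exists (b1' P); apply: (bij_inj bb0); rewrite -PE; apply: hom_ext => h.
  by rewrite b0E -hom_preE -b1E b1K.
have dV := GC_dim_Ext gV ntV; split=> //; split; first exact: GC_le_fin_gen gV.
  by rewrite dV.
rewrite dV; apply/(grade_semidualizing nR sC); split=> // -[_|j jm].
  exact/trivial_Ext_res0.
by apply/Ext0P/E5.
Qed.

Lemma reduced_GC_perfect_transpose X1 X0 M T (f : {linear X1 -> X0}) (p : {linear X0 -> M})
    (q : {linear Hom X1 C -> T}) (n t : int) :
  TR X1 -> TR X0 -> right_exact f p -> right_exact (dual f) q ->
  (reduced_GC_perfect C M /\ GC_dim C M = n%:E) /\
  (GC_perfect C (Extz M C n) /\ GC_dim C (Extz M C n) = (n + t - 1)%:E) ->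
  (reduced_GC_perfect C T /\ GC_dim C T = t%:E) /\
  (GC_perfect C (Extz T C t) /\ GC_dim C (Extz T C t) = (n + t - 1)%:E).
Proof.
move=> r1 r0 ef eq [[[_ _ rM] dM] [[_ _ gE] dE]].
have [n' nE] := inf_nat_int dM; subst n; move: rM; rewrite dM => rM.
have [m mE] := inf_nat_int dE; move: gE; rewrite dE mE => gE; move: dE; rewrite mE => dE.
(* The reduced grade runs over positive degrees, so [n] is a successor [k.+1]. *)
have [[n0 _] nM] := (inf_natP _ _).1 rM; case: n' n0 mE dM rM nM dE gE => // k _ mE dM _ nM.
rewrite -[Extz M C k.+1]/(Ext M C k.+1) => /GC_dimP[gE _] /(grade_semidualizing nR sC)[ntE tE].
have [gM ndM] := (GC_dimP _ _).1 dM.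
have iE := isExt_Ext C k M; set E := Ext M C k.+1 in iE ntE tE gE.
have [i ik|E1 _ E3 _] := transpose_Ext r1 r0 ef eq gM _ iE.
  by apply/Ext0P; apply: contrapT => nt; apply: (nM i.+1 ik).
have [t' m' gT] := E3 m gE (ndM 0%N isT).
have tt : t = t'.+1.
  have -> : t = (k.+1%:Z + t - 1) - k%:Z by rewrite -addn1 PoszD; ring.
  by rewrite mE m' -addnS PoszD; ring.
subst m t.
have iT := isExt_Ext C t' T.
have ET i U : isExt i T U -> iso (Ext E C (k + i).+1) U.
  by move=> /E1; apply: isExt_uniq; exact: isExt_Ext.
have ntT : ~ trivial_mod (Ext T C t'.+1).
  by move=> tT; apply: ntE; exact: trivial_iso (iso_sym (ET _ _ iT)) tT.
have dT := GC_dim_Ext gT ntT.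
(* By [E1], Ext^t(T, C) is the top dual Ext of the perfect module [E]. *)
split; last by apply: GC_perfect_dual gE tE ntE _; exact/E1.
split=> //; split; [exact: GC_le_fin_gen gT|by rewrite dT|rewrite dT].
apply/inf_natP; split=> // -[|j] jt [//] _; apply.
(* Ext^(j+1)(T, C) is Ext^(k+j+1)(E, C), a degree below the grade of [E]. *)
apply: trivial_iso (ET j _ (isExt_Ext C j T)) _; apply: tE.
by rewrite ltnS ltn_add2l.
Qed.

End Transpose.

Theorem theorem4p5 (R : comPzRingType) (C M : lmodType R) (n t : int)
    (P1 P0 : lmodType R) (f : {linear P1 -> P0}) (p : {linear P0 -> M}) :
  noetherian R -> semiperfect R -> semidualizing C -> fin_gen M ->
  fin_proj_presentation f p ->
  ((reduced_GC_perfect C M /\ GC_dim C M = n%:E) /\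
   (GC_perfect C (Extz M C n) /\ GC_dim C (Extz M C n) = (n + t - 1)%:E))
  <->
  ((reduced_GC_perfect C (Tr C f) /\ GC_dim C (Tr C f) = t%:E) /\
   (GC_perfect C (Extz (Tr C f) C t) /\
    GC_dim C (Extz (Tr C f) C t) = (n + t - 1)%:E)).
Proof.
move=> nR _ sC _ [[f1 p1] [f0 p0] ps pe].
have r1 := totally_reflexive_projective sC f1 p1.
have r0 := totally_reflexive_projective sC f0 p0.
have ef : right_exact f p by split.
have eq := coker_exact (hom_pre f (N := C)).
split; first exact: reduced_GC_perfect_transpose ef eq.
have [fC _ _] := sC.
have [b1 [bb1 b1E]] := bid_iso r1; have [b0 [bb0 b0E]] := bid_iso r0.
have [c0 [bK cK]] := inv_linear bb0; have [c1 [bK1 cK1]] := inv_linear bb1.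
have bf x : hom_pre (hom_pre f (N := C)) (N := C) (b1 x) = b0 (f x).
  by apply: hom_ext => h; rewrite b0E hom_preE b1E.
(* Through the inverse biduality [c0], [M] is the transpose of [Tr C f] for the dual
   presentation. *)
have ep : right_exact (hom_pre (hom_pre f (N := C)) (N := C)) (p \o c0).
  split=> [y|x]; first by have [x <-] := ps y; exists (b0 x); rewrite /= bK.
  rewrite /= pe; split=> -[y yE].
    by exists (b1 y); rewrite bf yE cK.
  by exists (c1 y); apply: (can_inj bK); rewrite -bf cK1 yE cK.
(* The common dimension is symmetric in [n] and [t], whose roles are exchanged. *)
rewrite [n + t]addrC; apply: reduced_GC_perfect_transpose eq ep => //.
  exact: totally_reflexive_dual.
exact: totally_reflexive_dual.
Qed.
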